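(* There is a Kleene index $e$ such that for every code $f$ of a Suslin set $P[f]\subseteq C$ (a $\Sigma_\alpha$- or $\Pi_\alpha$-code for some countable $\alpha$), the measure $\mathbf m(P[f])$ is computable in $\mathbf S$ and $f$ via $e$, in the sense that for every rational $q$, $\{e\}(\mathbf S,f,q)=0$ if $q<\mathbf m(P[f])$ and $=1$ otherwise (i.e. the Dedekind cut of $\mathbf m(P[f])$ is uniformly computable in $\mathbf S$ and $f$).
   Context: $C=\{0,1\}^{\mathbb N}$, $\mathbf m$ the completed uniform product measure on $C$. The Suslin functional: $\mathbf S(g)=0$ if $\forall f\in\mathbb N^{\mathbb N}\exists n\,g(\bar f(n))=0$, and $1$ if $\exists f\forall n\,g(\bar f(n))>0$, with $\bar f(n)=\langle f(0),\dots,f(n-1)\rangle$; computability is Kleene computability (S1–S9). Suslin sets: a Suslin scheme is $s\mapsto P_s$ on the set $\mathrm{SEQ}$ of finite sequences of naturals, $\mathbf A(\mathbf P)=\bigcup_f\bigcap_n P_{\bar f(n)}$; $\Sigma_0$ = clopen sets; $\Sigma_\alpha$ ($\alpha>0$) = sets $\mathbf A(\mathbf P)$ with each $P_s\in\Pi_\beta$, some $\beta<\alpha$; $\Pi_\alpha$ = complements; Suslin sets = $\bigcup_{\alpha<\omega_1}\Sigma_\alpha$. A code is a function in $\mathbb N^{\mathbb N}$ coding a well-founded labelled tree (leaves: clopen sets; inner nodes: complement, or $\mathbf A$ applied to the scheme of sets coded by children indexed by $\mathrm{SEQ}$); $P[f]$ is the coded set. All Suslin sets are $\mathbf m$-measurable.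 *)

(* Defs.v *)
From Stdlib Require Import Reals QArith List Arith Cantor ClassicalEpsilon.
Import ListNotations.
Open Scope nat_scope.

Fixpoint seqcode (s : list nat) : nat :=
  match s with
  | [] => 0
  | x :: t => S (Cantor.to_nat (x, seqcode t))
  end.

Definition fbar (f : nat -> nat) (n : nat) : nat :=
  seqcode (map f (seq 0 n)).

Definition Sfun (g : nat -> nat) : nat :=
  if excluded_middle_informative (exists f : nat -> nat, forall n, (g (fbar f n) > 0)%nat)
  then 1 else 0.

Record Args := mkArgs {
  nums : list nat;
  fns : list (nat -> nat);
  fnls : list ((nat -> nat) -> nat) }.

(* {e}(args) = z, relation defined by the schemes S1-S9;
   indices are seqcode's of lists [scheme number; parameters...]. *)
Inductive Comp : nat -> Args -> nat -> Prop :=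
| S1_succ : forall x xs fs Fs,
    Comp (seqcode [1]) (mkArgs (x :: xs) fs Fs) (S x)
| S2_const : forall q a,
    Comp (seqcode [2; q]) a q
| S3_proj : forall x xs fs Fs,
    Comp (seqcode [3]) (mkArgs (x :: xs) fs Fs) x
| S4_comp : forall e1 e2 xs fs Fs y z,
    Comp e2 (mkArgs xs fs Fs) y ->
    Comp e1 (mkArgs (y :: xs) fs Fs) z ->
    Comp (seqcode [4; e1; e2]) (mkArgs xs fs Fs) z
| S5_zero : forall e1 e2 xs fs Fs z,
    Comp e1 (mkArgs xs fs Fs) z ->
    Comp (seqcode [5; e1; e2]) (mkArgs (0 :: xs) fs Fs) z
| S5_succ : forall e1 e2 n xs fs Fs y z,
    Comp (seqcode [5; e1; e2]) (mkArgs (n :: xs) fs Fs) y ->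
    Comp e2 (mkArgs (y :: n :: xs) fs Fs) z ->
    Comp (seqcode [5; e1; e2]) (mkArgs (S n :: xs) fs Fs) z
| S6_perm_num : forall k e1 l1 x l2 fs Fs z,
    length l1 = k ->
    Comp e1 (mkArgs (x :: l1 ++ l2) fs Fs) z ->
    Comp (seqcode [6; 0; k; e1]) (mkArgs (l1 ++ x :: l2) fs Fs) z
| S6_perm_fn : forall k e1 xs l1 f l2 Fs z,
    length l1 = k ->
    Comp e1 (mkArgs xs (f :: l1 ++ l2) Fs) z ->
    Comp (seqcode [6; 1; k; e1]) (mkArgs xs (l1 ++ f :: l2) Fs) z
| S6_perm_fnl : forall k e1 xs fs l1 F l2 z,
    length l1 = k ->
    Comp e1 (mkArgs xs fs (F :: l1 ++ l2)) z ->
    Comp (seqcode [6; 2; k; e1]) (mkArgs xs fs (l1 ++ F :: l2)) z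
| S7_app1 : forall x xs f fs Fs,
    Comp (seqcode [7]) (mkArgs (x :: xs) (f :: fs) Fs) (f x)
| S8_app2 : forall e1 xs fs F Fs (h : nat -> nat),
    (forall y, Comp e1 (mkArgs (y :: xs) fs (F :: Fs)) (h y)) ->
    Comp (seqcode [8; e1]) (mkArgs xs fs (F :: Fs)) (F h)
| S9_enum : forall e' xs fs Fs z,
    Comp e' (mkArgs xs fs Fs) z ->
    Comp (seqcode [9]) (mkArgs (e' :: xs) fs Fs) z.

Definition Zcode (z : Z) : nat :=
  match z with
  | Z0 => 0
  | Zpos p => 2 * Pos.to_nat p
  | Zneg p => 2 * Pos.to_nat p - 1
  end.
Definition Qcode (q : Q) : nat := Cantor.to_nat (Zcode (Qnum q), Pos.to_nat (Qden q)).

Definition Cspace := nat -> bool.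

Definition cyl (s : list bool) (x : Cspace) : Prop :=
  forall i, i < length s -> x i = nth i s false.

Definition covers (A : Cspace -> Prop) (c : nat -> option (list bool)) : Prop :=
  forall x, A x -> exists n s, c n = Some s /\ cyl s x.

Definition weight (c : nat -> option (list bool)) (n : nat) : R :=
  match c n with
  | Some s => (/ 2) ^ length s
  | None => 0
  end%R.

Definition cover_sum (c : nat -> option (list bool)) (l : R) : Prop :=
  Un_cv (fun N => sum_f_R0 (weight c) N) l.

(* m_val A r : r = m*(A), the infimum of the total weights of countable covers of A
   by basic cylinders (the outer measure of the completed uniform product measure;
   for measurable A, e.g. Suslin sets, this is m(A)). *)
Definition m_val (A : Cspace -> Prop) (r : R) : Prop :=
  (forall c l, covers A c -> cover_sum c l -> (r <= l)%R) /\
  (forall eps, (0 < eps)%R -> exists c l, covers A c /\ cover_sum c l /\ (l < r + eps)%R).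

(* A code f : nat -> nat labels nodes sigma (finite sequences, node code seqcode sigma):
     f <sigma> = < 0, c_1, ..., c_k >  : leaf, clopen set  [b_1] u ... u [b_k]
                                        where c_i = seqcode b_i and a bit is 1 iff nonzero
     f <sigma> = < 1 >                : complement of the set coded at sigma ++ [0]
     f <sigma> = < 2 >                : Suslin operation A applied to the scheme
                                        s |-> set coded at sigma ++ [seqcode s].
   Den f sigma A : the (well-founded) subtree at sigma codes the set A. *)
Definition clopen_of (cs : list nat) (x : Cspace) : Prop :=
  exists b, In (seqcode b) cs /\ cyl (map (fun n => negb (Nat.eqb n 0)) b) x.

Inductive Den (f : nat -> nat) : list nat -> (Cspace -> Prop) -> Prop :=
| Den_leaf : forall sigma cs,
    f (seqcode sigma) = seqcode (0 :: cs) ->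
    Den f sigma (clopen_of cs)
| Den_compl : forall sigma A,
    f (seqcode sigma) = seqcode [1] ->
    Den f (sigma ++ [0]) A ->
    Den f sigma (fun x => ~ A x)
| Den_suslin : forall sigma (P : nat -> Cspace -> Prop),
    f (seqcode sigma) = seqcode [2] ->
    (forall n, Den f (sigma ++ [n]) (P n)) ->
    Den f sigma (fun x => exists g : nat -> nat, forall n, P (fbar g n) x).

Definition codes (f : nat -> nat) (A : Cspace -> Prop) : Prop := Den f [] A.

(* Main.v *)
Require Import Defs.
From Stdlib Require Import Reals QArith List.
From Stdlib Require Import ZArith Arith Lia Lra Cantor ClassicalEpsilon.
Import ListNotations.

(** Every coded set is approximated in measure by clopen sets, and for clopen [E_t]
    the measure of the Suslin set [A(E)] is the supremum over [h] of the infimum over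
    [n] of the measures of clopen sets [K_{h,n}] (the part of [A(E)] visible at stage
    [n] below [h]): "[<=]" because outer measure is continuous along increasing unions
    of arbitrary sets, "[>=]" because the intersection of the [K_{h,n}] lies in [A(E)]
    by König's lemma. Approximating each [P_t] within [delta 2^-(t+2)] by a clopen
    [E_t], "[q < m(A(P) ∩ D)]" for [D] clopen becomes: there are [delta] and a function
    coding [(E, h)] such that for all [n] an arithmetical condition on its first [n]
    values holds, relative to the predicates "[q' < m(P_t ∩ D')]"; one application of
    [S] decides it. Complements are handled by [m(D \ P) = m(D) - m(P ∩ D)], leaves by
    counting. This is a recursion along the well-founded tree, executed in Kleene's
    schemes by passing the program its own index as an argument of S9. *)

Open Scope nat_scope.

Local Opaque seqcode Cantor.to_nat Cantor.of_nat.

(** * Uniform computability in [Sfun] *)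

(** The clopen parameter [D] is forced: the distance from [P] to a clopen [E] is found from
    [m(P ∩ E)] and [m(P ∩ E')], with [E'] the complement of [E], so a call has to answer about
    [m(P ∩ D)] for every clopen [D]. Calls return strict lower cuts only; an upper bound is a
    negated answer, and dyadic thresholds turn all comparisons into inequalities between naturals.
    Clopen [E_t] are used because they are coded by numbers: [F t] pairs a code of [E_t] with
    [h(t)], and the condition gets the form [∃F ∀n R(fbar F n)] that [S] decides. Number quantifiers
    reduce to [S] as well, a number being the first value of a function, so arithmetical conditions
    on top of the calls are decidable too. Convergence is the delicate point. S8 asks for a total
    argument, and a self-call converges only at nodes that denote a set; below a complement only
    child 0 is known to. Hence the kind of node is found before any call is made, and only the index
    belonging to that kind is run. *)

Definition chi (P : Prop) : nat := if excluded_middle_informative P then 1 else 0.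

Lemma chi_true (P : Prop) : P -> chi P = 1.
Proof. unfold chi; destruct (excluded_middle_informative P); tauto. Qed.

Lemma chi_false (P : Prop) : ~ P -> chi P = 0.
Proof. unfold chi; destruct (excluded_middle_informative P); tauto. Qed.

Lemma chi_iff (P Q : Prop) : (P <-> Q) -> chi P = chi Q.
Proof.
  intros H; destruct (classic P) as [h|h].
  - rewrite !chi_true; tauto.
  - rewrite !chi_false; tauto.
Qed.

Lemma chi_pos (P : Prop) : chi P > 0 <-> P.
Proof. unfold chi; destruct (excluded_middle_informative P); intuition lia. Qed.

(* [v] is computable in [Sfun] and [fn x], uniformly in the abstract parameter
   [x : X], from the numbers [u x] for [u] in [ctx]. Partial computations are
   covered by letting [X] carry hypotheses; the junk [tl] makes weakening possible,
   as no scheme discards an argument. *)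
Definition cp {X : Type} (fn : X -> nat -> nat) (ctx : list (X -> nat)) (v : X -> nat) : Prop :=
  exists e, forall x tl,
    Comp e (mkArgs (map (fun u => u x) ctx ++ tl) [fn x] [Sfun]) (v x).

Definition lift {X : Type} (ctx : list (X -> nat)) : list (X * nat -> nat) :=
  map (fun u p => u (fst p)) ctx.

Definition bind {X : Type} (ctx : list (X -> nat)) : list (X * nat -> nat) :=
  (fun p => snd p) :: lift ctx.

Lemma map_bind {X} (ctx : list (X -> nat)) p :
  map (fun u => u p) (bind ctx) = snd p :: map (fun u => u (fst p)) ctx.
Proof. unfold bind, lift; simpl; rewrite map_map; reflexivity. Qed.

Section Closure.
Context {X : Type} {fn : X -> nat -> nat}.
Implicit Type ctx : list (X -> nat).

Lemma cp_ext {ctx} v w : (forall x, v x = w x) -> cp fn ctx v -> cp fn ctx w.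
Proof. intros H [e He]; exists e; intros x tl; rewrite <- H; apply He. Qed.

Lemma cp_const {ctx} c : cp fn ctx (fun _ => c).
Proof. exists (seqcode [2; c]); intros; constructor. Qed.

Lemma cp_var {ctx} k v : nth_error ctx k = Some v -> cp fn ctx v.
Proof.
  intros H; exists (seqcode [6; 0; k; seqcode [3]]); intros x tl.
  apply nth_error_split in H as (l1 & l2 & -> & Hk).
  rewrite map_app, <- app_assoc; simpl.
  apply S6_perm_num; [now rewrite length_map | constructor].
Qed.

Lemma cp_let {ctx} a v : cp fn ctx a -> cp fn (a :: ctx) v -> cp fn ctx v.
Proof.
  intros [e He] [e' He']; exists (seqcode [4; e'; e]); intros x tl.
  eapply S4_comp; [apply He | apply He'].
Qed.

(** Each S6 brings the entry at position [k] to the head, so [m] of them rotate the last [m] of the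
    first [k + 1] arguments to the front. Weakening uses this to move the new variable behind the
    context, where it joins the junk [tl]. *)
Fixpoint rot (k m e : nat) : nat :=
  match m with 0 => e | S m => seqcode [6; 0; k; rot k m e] end.

Lemma rotP k e fs Fs z tl : forall B A : list nat,
  length A + length B = S k ->
  Comp e (mkArgs (B ++ A ++ tl) fs Fs) z ->
  Comp (rot k (length B) e) (mkArgs (A ++ B ++ tl) fs Fs) z.
Proof.
  intros B; induction B as [|x B IH] using rev_ind; intros A Hk H; [exact H|].
  rewrite length_app, Nat.add_1_r; cbn [rot].
  rewrite length_app in Hk; simpl in Hk.
  replace (A ++ (B ++ [x]) ++ tl) with ((A ++ B) ++ x :: tl)
    by now rewrite <- !app_assoc.
  apply S6_perm_num; [rewrite length_app; lia|].
  rewrite <- app_assoc.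
  apply (IH (x :: A)); [simpl; lia|].
  now rewrite <- app_assoc in H.
Qed.

Lemma cp_weak1 {ctx} u v : cp fn ctx v -> cp fn (u :: ctx) v.
Proof.
  intros [e He]; exists (rot (length ctx) (length ctx) e); intros x tl.
  specialize (He x (u x :: tl)).
  pose proof (rotP (length ctx) e [fn x] [Sfun] (v x) tl (map (fun u => u x) ctx) [u x]) as H.
  rewrite length_map in H; apply H; [reflexivity | exact He].
Qed.

Lemma cp_weak {ctx} l v : cp fn ctx v -> cp fn (l ++ ctx) v.
Proof. intros H; induction l as [|u l IH]; [exact H | exact (cp_weak1 u v IH)]. Qed.

Lemma cp_lets {ctx} l v : Forall (cp fn ctx) l -> cp fn (l ++ ctx) v -> cp fn ctx v.
Proof.
  intros Hl; revert v; induction Hl as [|a l Ha Hl IH]; intros v H; [exact H|].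
  apply IH; apply (cp_let a); [now apply cp_weak | exact H].
Qed.

Lemma cp_subst {ctx} l v : Forall (cp fn ctx) l -> cp fn l v -> cp fn ctx v.
Proof.
  intros Hl [e He]; apply (cp_lets l _ Hl); exists e; intros x tl.
  rewrite map_app, <- app_assoc; apply He.
Qed.

Lemma cp_self ctx : Forall (cp fn ctx) ctx.
Proof.
  apply Forall_forall; intros u Hu.
  apply In_nth_error in Hu as [k Hk]; exact (cp_var k u Hk).
Qed.

Lemma cp_S {ctx} a : cp fn ctx a -> cp fn ctx (fun x => S (a x)).
Proof.
  intros Ha; apply (cp_let a _ Ha).
  exists (seqcode [1]); intros; simpl; constructor.
Qed.

Lemma cp_fn {ctx} a : cp fn ctx a -> cp fn ctx (fun x => fn x (a x)).
Proof.
  intros Ha; apply (cp_let a _ Ha).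
  exists (seqcode [7]); intros; simpl; constructor.
Qed.

(** S9 with an index that is itself computed: a program that holds its own index among its inputs
    can call itself this way. *)
Lemma cp_call {ctx} (l : list (X -> nat)) E v :
  cp fn ctx E -> Forall (cp fn ctx) l ->
  (forall x tl, Comp (E x) (mkArgs (map (fun u => u x) l ++ tl) [fn x] [Sfun]) (v x)) ->
  cp fn ctx v.
Proof.
  intros HE Hl H; apply (cp_lets l _ Hl).
  apply (cp_let E); [now apply cp_weak|].
  exists (seqcode [9]); intros x tl; simpl; apply S9_enum.
  rewrite map_app, <- app_assoc; apply H.
Qed.

Lemma cp_rec {ctx} n b (s : X -> nat -> nat -> nat) :
  cp fn ctx n -> cp fn ctx b ->
  cp (fun p => fn (fst (fst p))) (bind (bind ctx))
     (fun p => s (fst (fst p)) (snd (fst p)) (snd p)) ->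
  cp fn ctx (fun x => nat_rect (fun _ => nat) (b x) (s x) (n x)).
Proof.
  intros Hn [e1 H1] [e2 H2]; apply (cp_let n _ Hn).
  exists (seqcode [5; e1; e2]); intros x tl; simpl map; simpl app.
  induction (n x) as [|k IH]; simpl nat_rect.
  - apply S5_zero, H1.
  - eapply S5_succ; [exact IH|].
    specialize (H2 (x, k, nat_rect (fun _ => nat) (b x) (s x) k) tl).
    rewrite !map_bind in H2; exact H2.
Qed.

Lemma cp_Sfun {ctx} (v : X -> nat -> nat) :
  cp (fun p => fn (fst p)) (bind ctx) (fun p => v (fst p) (snd p)) ->
  cp fn ctx (fun x => Sfun (v x)).
Proof.
  intros [e He]; exists (seqcode [8; e]); intros x tl.
  apply S8_app2; intros y.
  specialize (He (x, y) tl); now rewrite map_bind in He.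
Qed.

End Closure.

Lemma cp_lift {X} {fn : X -> nat -> nat} {ctx v} :
  cp fn ctx v -> cp (fun p : X * nat => fn (fst p)) (bind ctx) (fun p => v (fst p)).
Proof.
  intros [e He]; apply (cp_weak1 (ctx := lift ctx)).
  exists e; intros [x y] tl; unfold lift; rewrite map_map; apply He.
Qed.

(** The test selects an index, and S9 then runs that index alone. Each branch has to converge only
    on its own summand, which combining the two values arithmetically would not allow. *)
Lemma cp_case {X Y} (fn : X + Y -> nat -> nat) ctx v (P : X + Y -> Prop) :
  (forall x, P (inl x)) -> (forall y, ~ P (inr y)) ->
  cp fn ctx (fun z => chi (P z)) ->
  cp (fun x => fn (inl x)) (map (fun u x => u (inl x)) ctx) (fun x => v (inl x)) ->
  cp (fun y => fn (inr y)) (map (fun u y => u (inr y)) ctx) (fun y => v (inr y)) ->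
  cp fn ctx v.
Proof.
  intros HX HY HP [e1 H1] [e2 H2].
  apply (cp_let (fun z => nat_rect (fun _ => nat) e2 (fun _ _ => e1) (chi (P z)))).
  { apply (cp_rec (fun z => chi (P z)) (fun _ => e2) (fun _ _ _ => e1));
      auto using cp_const. }
  exists (seqcode [9]); intros z tl; simpl; apply S9_enum.
  destruct z as [x|y].
  - rewrite (chi_true _ (HX x)); simpl.
    specialize (H1 x tl); now rewrite map_map in H1.
  - rewrite (chi_false _ (HY y)); simpl.
    specialize (H2 y tl); now rewrite map_map in H2.
Qed.

Ltac cpv :=
  let rec go k := first [apply (cp_var k); reflexivity
    | lazymatch k with 20 => fail | _ => let k' := eval cbv in (S k) in go k' end] in
  go 0.

Ltac cph := match goal with
  | H : cp _ _ _ |- _ => first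
      [exact H | exact (cp_lift H) | exact (cp_lift (cp_lift H))
      | exact (cp_lift (cp_lift (cp_lift H))) ]
  end.

(** * Arithmetic, pairing and number quantifiers *)

Fixpoint bsum (n : nat) (g : nat -> nat) : nat :=
  match n with 0 => 0 | S n => bsum n g + g n end.

Lemma bsum_ext n g h : (forall k, k < n -> g k = h k) -> bsum n g = bsum n h.
Proof. induction n; simpl; intros H; [reflexivity|]; rewrite IHn, H; auto. Qed.

Lemma bsum_single n k w : k < n -> bsum n (fun i => chi (i = k) * w) = w.
Proof.
  assert (Z : forall m, m <= k -> bsum m (fun i => chi (i = k) * w) = 0).
  { induction m; simpl; intros; [reflexivity|].
    rewrite IHm, chi_false by lia; reflexivity. }
  induction n as [|n IH]; intros H; [lia|]; simpl.
  destruct (Nat.eq_dec n k) as [->|h].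
  - rewrite Z, chi_true by lia; lia.
  - rewrite IH, (chi_false (n = k)) by lia; lia.
Qed.

Definition hdc (c : nat) : nat := fst (Cantor.of_nat (pred c)).
Definition tlc (c : nat) : nat := snd (Cantor.of_nat (pred c)).

Lemma cp_add {X} {fn : X -> nat -> nat} {ctx} a b :
  cp fn ctx a -> cp fn ctx b -> cp fn ctx (fun x => a x + b x).
Proof.
  intros Ha Hb.
  apply (cp_ext (fun x => nat_rect (fun _ => nat) (b x) (fun _ y => S y) (a x))).
  { intros x; induction (a x); simpl; congruence. }
  apply (cp_rec a b (fun _ _ y => S y)); auto.
  apply cp_S; cpv.
Qed.

Lemma cp_mul {X} {fn : X -> nat -> nat} {ctx} a b :
  cp fn ctx a -> cp fn ctx b -> cp fn ctx (fun x => a x * b x).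
Proof.
  intros Ha Hb.
  apply (cp_ext (fun x => nat_rect (fun _ => nat) 0 (fun _ y => b x + y) (a x))).
  { intros x; induction (a x); simpl; congruence. }
  apply (cp_rec a (fun _ => 0) (fun x _ y => b x + y)); auto using cp_const.
  apply cp_add; [cph | cpv].
Qed.

Lemma cp_pred {X} {fn : X -> nat -> nat} {ctx} a : cp fn ctx a -> cp fn ctx (fun x => pred (a x)).
Proof.
  intros Ha.
  apply (cp_ext (fun x => nat_rect (fun _ => nat) 0 (fun k _ => k) (a x))).
  { intros x; destruct (a x); reflexivity. }
  apply (cp_rec a (fun _ => 0) (fun _ k _ => k)); auto using cp_const.
  cpv.
Qed.

Lemma cp_sub {X} {fn : X -> nat -> nat} {ctx} a b :
  cp fn ctx a -> cp fn ctx b -> cp fn ctx (fun x => a x - b x).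
Proof.
  intros Ha Hb.
  apply (cp_ext (fun x => nat_rect (fun _ => nat) (a x) (fun _ y => pred y) (b x))).
  { intros x; induction (b x); simpl; lia. }
  apply (cp_rec b a (fun _ _ y => pred y)); auto.
  apply cp_pred; cpv.
Qed.

Lemma cp_pow {X} {fn : X -> nat -> nat} {ctx} a b :
  cp fn ctx a -> cp fn ctx b -> cp fn ctx (fun x => a x ^ b x).
Proof.
  intros Ha Hb.
  apply (cp_ext (fun x => nat_rect (fun _ => nat) 1 (fun _ y => a x * y) (b x))).
  { intros x; induction (b x); simpl; congruence. }
  apply (cp_rec b (fun _ => 1) (fun x _ y => a x * y)); auto using cp_const.
  apply cp_mul; [cph | cpv].
Qed.

Lemma cp_bsum {X} {fn : X -> nat -> nat} {ctx} n g :
  cp fn ctx n -> cp (fun p => fn (fst p)) (bind ctx) (fun p => g (fst p) (snd p)) ->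
  cp fn ctx (fun x => bsum (n x) (g x)).
Proof.
  intros Hn Hg.
  apply (cp_ext (fun x => nat_rect (fun _ => nat) 0 (fun k y => y + g x k) (n x))).
  { intros x; induction (n x); simpl; congruence. }
  apply (cp_rec n (fun _ => 0) (fun x k y => y + g x k)); auto using cp_const.
  apply cp_add; [cpv | cph].
Qed.

Lemma cp_le {X} {fn : X -> nat -> nat} {ctx} a b :
  cp fn ctx a -> cp fn ctx b -> cp fn ctx (fun x => chi (a x <= b x)).
Proof.
  intros Ha Hb; apply (cp_ext (fun x => 1 - (a x - b x))).
  - intros x; destruct (le_lt_dec (a x) (b x));
      [rewrite chi_true | rewrite chi_false]; lia.
  - apply cp_sub; [apply cp_const | now apply cp_sub].
Qed.

Lemma cp_lt {X} {fn : X -> nat -> nat} {ctx} a b :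
  cp fn ctx a -> cp fn ctx b -> cp fn ctx (fun x => chi (a x < b x)).
Proof. intros Ha Hb; apply (cp_le (fun x => S (a x))); [now apply cp_S | exact Hb]. Qed.

Lemma cp_not {X} {fn : X -> nat -> nat} {ctx} P :
  cp fn ctx (fun x => chi (P x)) -> cp fn ctx (fun x => chi (~ P x)).
Proof.
  intros H; apply (cp_ext (fun x => 1 - chi (P x))).
  - intros x; destruct (classic (P x)).
    + rewrite chi_true, chi_false; tauto.
    + rewrite chi_false, chi_true; tauto.
  - apply cp_sub; [apply cp_const | exact H].
Qed.

Lemma cp_and {X} {fn : X -> nat -> nat} {ctx} P Q :
  cp fn ctx (fun x => chi (P x)) -> cp fn ctx (fun x => chi (Q x)) ->
  cp fn ctx (fun x => chi (P x /\ Q x)).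
Proof.
  intros HP HQ; apply (cp_ext (fun x => chi (P x) * chi (Q x))).
  - intros x; unfold chi; repeat destruct excluded_middle_informative; tauto.
  - now apply cp_mul.
Qed.

Lemma cp_pext {X} {fn : X -> nat -> nat} {ctx} P Q : (forall x, P x <-> Q x) ->
  cp fn ctx (fun x => chi (P x)) -> cp fn ctx (fun x => chi (Q x)).
Proof. intros H; apply cp_ext; intros x; now apply chi_iff. Qed.

Lemma cp_imp {X} {fn : X -> nat -> nat} {ctx} P Q :
  cp fn ctx (fun x => chi (P x)) -> cp fn ctx (fun x => chi (Q x)) ->
  cp fn ctx (fun x => chi (P x -> Q x)).
Proof.
  intros HP HQ; apply (cp_pext (fun x => ~ (P x /\ ~ Q x))).
  - intros x; destruct (classic (P x)), (classic (Q x)); tauto.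
  - apply cp_not, cp_and, cp_not; assumption.
Qed.

Lemma cp_or {X} {fn : X -> nat -> nat} {ctx} P Q :
  cp fn ctx (fun x => chi (P x)) -> cp fn ctx (fun x => chi (Q x)) ->
  cp fn ctx (fun x => chi (P x \/ Q x)).
Proof.
  intros HP HQ; apply (cp_pext (fun x => ~ P x -> Q x)).
  - intros x; destruct (classic (P x)); tauto.
  - apply cp_imp; [apply cp_not|]; assumption.
Qed.

Lemma cp_iff {X} {fn : X -> nat -> nat} {ctx} P Q :
  cp fn ctx (fun x => chi (P x)) -> cp fn ctx (fun x => chi (Q x)) ->
  cp fn ctx (fun x => chi (P x <-> Q x)).
Proof. intros HP HQ; apply cp_and; apply cp_imp; assumption. Qed.

Lemma cp_eq {X} {fn : X -> nat -> nat} {ctx} a b :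
  cp fn ctx a -> cp fn ctx b -> cp fn ctx (fun x => chi (a x = b x)).
Proof.
  intros Ha Hb; apply (cp_pext (fun x => a x <= b x /\ b x <= a x)); [lia|].
  apply cp_and; apply cp_le; assumption.
Qed.

(** Cantor's pairing of [a] and [b] is [b] plus the triangular number of [b + a], a sum that S5
    computes. *)
Lemma cp_pair {X} {fn : X -> nat -> nat} {ctx} a b : cp fn ctx a -> cp fn ctx b ->
  cp fn ctx (fun x => Cantor.to_nat (a x, b x)).
Proof.
  intros Ha Hb.
  apply (cp_ext (fun x => b x + nat_rect (fun _ => nat) 0 (fun i m => S i + m) (b x + a x)));
    [reflexivity|].
  apply cp_add; [exact Hb|].
  apply (cp_rec (fun x => b x + a x) (fun _ => 0) (fun _ i m => S i + m));
    auto using cp_const, cp_add.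
  apply (cp_add (fun p => S (snd (fst p)))); [apply cp_S; cpv | cpv].
Qed.

Lemma to_nat_le x y : x <= Cantor.to_nat (x, y) /\ y <= Cantor.to_nat (x, y).
Proof. pose proof (Cantor.to_nat_non_decreasing x y); lia. Qed.

Lemma unpair_eq z x y :
  Cantor.to_nat (x, y) = z <-> x = fst (Cantor.of_nat z) /\ y = snd (Cantor.of_nat z).
Proof.
  split.
  - intros <-; now rewrite Cantor.cancel_of_to.
  - intros [-> ->]; now rewrite <- surjective_pairing, Cantor.cancel_to_of.
Qed.

Lemma unpair_le z : fst (Cantor.of_nat z) <= z /\ snd (Cantor.of_nat z) <= z.
Proof.
  destruct (unpair_eq z (fst (Cantor.of_nat z)) (snd (Cantor.of_nat z))) as [_ H].
  pose proof (to_nat_le (fst (Cantor.of_nat z)) (snd (Cantor.of_nat z))).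
  rewrite H in *; auto.
Qed.

(** Unpairing by bounded search: both components are at most [z] and a single pair contributes to
    the double sum. With [w] a projection, the components become computable. *)
Lemma unpair_sum z (w : nat -> nat -> nat) :
  bsum (S z) (fun x => bsum (S z) (fun y => chi (Cantor.to_nat (x, y) = z) * w x y)) =
  w (fst (Cantor.of_nat z)) (snd (Cantor.of_nat z)).
Proof.
  destruct (unpair_le z) as [H1 H2].
  set (x0 := fst (Cantor.of_nat z)) in *; set (y0 := snd (Cantor.of_nat z)) in *.
  transitivity (bsum (S z) (fun x => chi (x = x0) * w x0 y0));
    [|apply bsum_single; lia].
  apply bsum_ext; intros x _.
  transitivity (bsum (S z) (fun y => chi (y = y0) * (chi (x = x0) * w x0 y0)));
    [|apply bsum_single; lia].
  apply bsum_ext; intros y _.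
  destruct (classic (Cantor.to_nat (x, y) = z)) as [h|h].
  - rewrite (chi_true _ h); apply unpair_eq in h as [-> ->].
    fold x0 y0; rewrite !chi_true by reflexivity; lia.
  - rewrite (chi_false _ h); rewrite unpair_eq in h; fold x0 y0 in h.
    destruct (Nat.eq_dec y y0) as [hy|hy]; [|now rewrite (chi_false _ hy)].
    rewrite (chi_false (x = x0)) by tauto; lia.
Qed.

Lemma cp_fst {X} {fn : X -> nat -> nat} {ctx} a :
  cp fn ctx a -> cp fn ctx (fun x => fst (Cantor.of_nat (a x))).
Proof.
  intros Ha; eapply cp_ext; [intros x; apply (unpair_sum (a x) (fun u _ => u))|].
  apply cp_bsum; [now apply cp_S|].
  apply cp_bsum; [apply cp_S; cph|].
  apply cp_mul; [apply cp_eq; [apply cp_pair; cpv | cph] | cpv].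
Qed.

Lemma cp_snd {X} {fn : X -> nat -> nat} {ctx} a :
  cp fn ctx a -> cp fn ctx (fun x => snd (Cantor.of_nat (a x))).
Proof.
  intros Ha; eapply cp_ext; [intros x; apply (unpair_sum (a x) (fun _ v => v))|].
  apply cp_bsum; [now apply cp_S|].
  apply cp_bsum; [apply cp_S; cph|].
  apply cp_mul; [apply cp_eq; [apply cp_pair; cpv | cph] | cpv].
Qed.

Lemma cp_hdc {X} {fn : X -> nat -> nat} {ctx} a : cp fn ctx a -> cp fn ctx (fun x => hdc (a x)).
Proof. intros Ha; now apply cp_fst, cp_pred. Qed.

Lemma cp_tlc {X} {fn : X -> nat -> nat} {ctx} a : cp fn ctx a -> cp fn ctx (fun x => tlc (a x)).
Proof. intros Ha; now apply cp_snd, cp_pred. Qed.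

Lemma cp_Suslin {X} {fn : X -> nat -> nat} {ctx} (R : X -> nat -> Prop) :
  cp (fun p => fn (fst p)) (bind ctx) (fun p => chi (R (fst p) (snd p))) ->
  cp fn ctx (fun x => chi (exists F, forall n, R x (fbar F n))).
Proof.
  intros H; apply (cp_ext (fun x => Sfun (fun c => chi (R x c)))).
  - intros x; unfold Sfun; fold (chi (exists F, forall n, chi (R x (fbar F n)) > 0)).
    apply chi_iff; split; intros [F HF]; exists F; intros n; apply chi_pos, HF.
  - now apply cp_Sfun.
Qed.

Lemma seqcode_cons x s : seqcode (x :: s) = S (Cantor.to_nat (x, seqcode s)).
Proof. reflexivity. Qed.

Lemma hdc_cons x s : hdc (seqcode (x :: s)) = x.
Proof. unfold hdc; rewrite seqcode_cons; simpl pred; now rewrite Cantor.cancel_of_to. Qed.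

Lemma tlc_cons x s : tlc (seqcode (x :: s)) = seqcode s.
Proof. unfold tlc; rewrite seqcode_cons; simpl pred; now rewrite Cantor.cancel_of_to. Qed.

(** Substitution in the bound slot: [Sfun] supplies a code [fbar F n], while the matrix is wanted at
    a number computed from it, such as its head. *)
Lemma cp_inst {X} {fn : X -> nat -> nat} {ctx} (v : X -> nat -> nat) (a : X * nat -> nat) :
  cp (fun p => fn (fst p)) (bind ctx) (fun p => v (fst p) (snd p)) ->
  cp (fun p => fn (fst p)) (bind ctx) a ->
  cp (fun p => fn (fst p)) (bind ctx) (fun p => v (fst p) (a p)).
Proof.
  intros [e He] Ha; apply (cp_subst (a :: lift ctx)).
  - constructor; [exact Ha | exact (Forall_inv_tail (cp_self (bind ctx)))].
  - exists e; intros x t.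
    specialize (He (fst x, a x) t); rewrite map_bind in He.
    unfold lift; rewrite map_cons, map_map; exact He.
Qed.

(** The witness is the first value of the function quantified by [Sfun]. The empty sequence, with
    code 0, has no head yet; the disjunct exempts it. *)
Lemma cp_ex {X} {fn : X -> nat -> nat} {ctx} (P : X -> nat -> Prop) :
  cp (fun p => fn (fst p)) (bind ctx) (fun p => chi (P (fst p) (snd p))) ->
  cp fn ctx (fun x => chi (exists y, P x y)).
Proof.
  intros H.
  apply (cp_pext (fun x => exists F, forall n, fbar F n = 0 \/ P x (hdc (fbar F n)))).
  - intros x; split.
    + intros [F HF]; exists (F 0); destruct (HF 1) as [h|h]; [discriminate h|].
      unfold fbar in h; simpl map in h; now rewrite hdc_cons in h.
    + intros [y Hy]; exists (fun _ => y); intros [|n]; [now left|right].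
      unfold fbar; simpl map; now rewrite hdc_cons.
  - apply (cp_Suslin (fun x c => c = 0 \/ P x (hdc c))).
    apply cp_or; [apply cp_eq; [cpv | apply cp_const]|].
    apply (cp_inst (fun x y => chi (P x y)) (fun p => hdc (snd p)) H), cp_hdc; cpv.
Qed.

Lemma cp_all {X} {fn : X -> nat -> nat} {ctx} (P : X -> nat -> Prop) :
  cp (fun p => fn (fst p)) (bind ctx) (fun p => chi (P (fst p) (snd p))) ->
  cp fn ctx (fun x => chi (forall y, P x y)).
Proof.
  intros H; apply (cp_pext (fun x => ~ exists y, ~ P x y)).
  - intros x; split; [|firstorder].
    intros h y; apply NNPP; intros n; apply h; now exists y.
  - apply cp_not, cp_ex, (cp_not (fun p => P (fst p) (snd p))), H.
Qed.

(** * Finite sequences and clopen sets as numbers *)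

(** Codes carry no length. Since [tlc 0 = 0], dropping too much stays at 0, while a nonempty
    sequence has a positive code; this is what makes [inb] a length test. *)
Definition drp (i c : nat) : nat := nat_rect (fun _ => nat) c (fun _ y => tlc y) i.
Definition inb (i c : nat) : Prop := drp i c <> 0.
Definition nthc (i c : nat) : nat := hdc (drp i c).

(** Quantifiers over numbers can therefore serve as quantifiers over sequences, and every child of a
    Suslin node belongs to the scheme. *)
Lemma seqcode_surj c : exists s, seqcode s = c.
Proof.
  induction c as [[|c] IH] using lt_wf_ind; [now exists []|].
  destruct (IH (snd (Cantor.of_nat c))) as [s Hs].
  { pose proof (unpair_le c); lia. }
  exists (fst (Cantor.of_nat c) :: s).
  rewrite seqcode_cons, Hs, <- surjective_pairing; now rewrite Cantor.cancel_to_of.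
Qed.

Lemma seqcode_inj s t : seqcode s = seqcode t -> s = t.
Proof.
  revert t; induction s as [|x s IH]; intros [|y t] H; try discriminate H; [reflexivity|].
  rewrite !seqcode_cons in H; injection H as H.
  apply Cantor.to_nat_inj in H; injection H as -> H; f_equal; auto.
Qed.

Lemma drp_code i s : drp i (seqcode s) = seqcode (skipn i s).
Proof.
  revert s; induction i as [|i IH]; intros s; [reflexivity|].
  change (drp (S i) (seqcode s)) with (tlc (drp i (seqcode s))); rewrite IH.
  clear IH; revert s; induction i as [|i IH]; intros [|x s]; simpl skipn;
    try reflexivity; try apply tlc_cons; apply IH.
Qed.

Lemma inb_code i s : inb i (seqcode s) <-> i < length s.
Proof.
  unfold inb; rewrite drp_code; pose proof (length_skipn i s) as L.
  destruct (skipn i s) as [|x t]; simpl length in L.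
  - split; [intros h; now destruct h | lia].
  - split; [lia|]; intros _ E; discriminate E.
Qed.

Lemma nthc_code i s : nthc i (seqcode s) = nth i s 0.
Proof.
  unfold nthc; rewrite drp_code.
  revert s; induction i as [|i IH]; intros [|x s]; simpl skipn; simpl nth; auto using hdc_cons.
Qed.

Lemma length_le_code s : length s <= seqcode s.
Proof.
  induction s as [|x s IH]; [simpl; lia|]; rewrite seqcode_cons; simpl.
  pose proof (to_nat_le x (seqcode s)); lia.
Qed.

Lemma In_lt_code x s : In x s -> x < seqcode s.
Proof.
  induction s as [|y s IH]; simpl; [tauto|]; rewrite seqcode_cons.
  pose proof (to_nat_le y (seqcode s)); intros [->|Hx]; [lia|]; specialize (IH Hx); lia.
Qed.

(** The number [u] stands for the point of [C] whose coordinates are its binary digits; [b] and the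
    [e] of [memP] code a string and a clopen set in the format of the leaf labels. *)
Definition cylP (u b : nat) : Prop :=
  forall k, inb k b -> (nthc k b <> 0 <-> Nat.testbit u k = true).
Definition memP (u e : nat) : Prop := exists i, inb i e /\ cylP u (nthc i e).

(* The code of the reversed list stands for a node, so that passing to a child is a cons. *)
Definition revP (y l : nat) : Prop :=
  exists n, (forall i, inb i y <-> i < n) /\ (forall i, inb i l <-> i < n) /\
    forall i, i < n -> nthc i y = nthc (n - S i) l.

Lemma revP_code y s : revP y (seqcode s) <-> y = seqcode (rev s).
Proof.
  destruct (seqcode_surj y) as [t <-]; unfold revP; split.
  - intros (n & Ht & Hs & H).
    assert (Lt : length t = n).
    { pose proof (Ht n); pose proof (Ht (length t)); rewrite inb_code in *; lia. }
    assert (Ls : length s = n).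
    { pose proof (Hs n); pose proof (Hs (length s)); rewrite inb_code in *; lia. }
    f_equal; apply (nth_ext _ _ 0 0); [rewrite length_rev; lia|].
    intros i Hi; rewrite rev_nth by lia; rewrite Ls.
    rewrite <- !nthc_code; apply H; lia.
  - intros H; apply seqcode_inj in H as ->; exists (length s).
    split; [intros i; now rewrite inb_code, length_rev|].
    split; [intros i; apply inb_code|].
    intros i Hi; rewrite !nthc_code; now apply rev_nth.
Qed.

Lemma testbitP u k :
  Nat.testbit u k = true <-> exists v w, w < 2 ^ k /\ u = (2 * v + 1) * 2 ^ k + w.
Proof.
  split.
  - intros H; destruct (Nat.testbit_spec u k) as (w & v & Hw & E).
    rewrite H in E; exists v, w; simpl Nat.b2n in E; lia.
  - intros (v & w & Hw & E).
    apply (Nat.testbit_unique u k true w v); simpl Nat.b2n; lia.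
Qed.

Section CodePredicates.
Context {X : Type} {fn : X -> nat -> nat} {ctx : list (X -> nat)}.

Lemma cp_drp i c : cp fn ctx i -> cp fn ctx c -> cp fn ctx (fun x => drp (i x) (c x)).
Proof.
  intros Hi Hc; apply (cp_rec i c (fun _ _ y => tlc y)); auto.
  apply cp_tlc; cpv.
Qed.

Lemma cp_nthc i c : cp fn ctx i -> cp fn ctx c -> cp fn ctx (fun x => nthc (i x) (c x)).
Proof. intros; now apply cp_hdc, cp_drp. Qed.

Lemma cp_inb i c : cp fn ctx i -> cp fn ctx c -> cp fn ctx (fun x => chi (inb (i x) (c x))).
Proof.
  intros; apply (cp_not (fun x => drp (i x) (c x) = 0)), cp_eq;
    [now apply cp_drp | apply cp_const].
Qed.
End CodePredicates.

Ltac cps :=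
  lazymatch goal with
  | |- cp _ _ (fun x => chi (_ /\ _)) => apply cp_and
  | |- cp _ _ (fun x => chi (_ \/ _)) => apply cp_or
  | |- cp _ _ (fun x => chi (_ <-> _)) => apply cp_iff
  | |- cp _ _ (fun x => chi (~ _)) => apply cp_not
  | |- cp _ _ (fun x => chi (exists y, _)) => apply cp_ex
  | |- cp _ _ (fun x => chi (forall y : nat, _)) => apply cp_all
  | |- cp _ _ (fun x => chi (_ -> _)) => apply cp_imp
  | |- cp _ _ (fun x => chi (_ <= _)) => apply cp_le
  | |- cp _ _ (fun x => chi (_ < _)) => apply cp_lt
  | |- cp _ _ (fun x => chi (_ = _)) => apply cp_eq
  | |- cp _ _ (fun x => chi (inb _ _)) => apply cp_inb
  | |- cp _ _ (fun x => _ + _) => apply cp_add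
  | |- cp _ _ (fun x => _ - _) => apply cp_sub
  | |- cp _ _ (fun x => _ * _) => apply cp_mul
  | |- cp _ _ (fun x => _ ^ _) => apply cp_pow
  | |- cp _ _ (fun x => nthc _ _) => apply cp_nthc
  | |- cp _ _ (fun x => bsum _ _) => apply cp_bsum
  | |- cp _ _ (fun x => Cantor.to_nat _) => apply cp_pair
  | |- cp _ _ (fun x => fst (Cantor.of_nat _)) => apply cp_fst
  | |- cp _ _ (fun x => snd (Cantor.of_nat _)) => apply cp_snd
  end.
Ltac cpu := fail.
Ltac cpt := cbv beta; repeat first [cph | cpu | cps | cpv | apply cp_const | apply cp_S].

Lemma cp_revP {X} {fn : X -> nat -> nat} {ctx} y l :
  cp fn ctx y -> cp fn ctx l -> cp fn ctx (fun x => chi (revP (y x) (l x))).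
Proof. intros; unfold revP; cpt. Qed.

Lemma cp_testbit {X} {fn : X -> nat -> nat} {ctx} u k :
  cp fn ctx u -> cp fn ctx k -> cp fn ctx (fun x => chi (Nat.testbit (u x) (k x) = true)).
Proof.
  intros; eapply cp_pext; [intros x; symmetry; apply testbitP|].
  cpt.
Qed.

Lemma cp_memP {X} {fn : X -> nat -> nat} {ctx} u e :
  cp fn ctx u -> cp fn ctx e -> cp fn ctx (fun x => chi (memP (u x) (e x))).
Proof.
  intros; unfold memP, cylP.
  do 4 (cpt; try apply cp_testbit).
Qed.

Ltac cpu ::= lazymatch goal with
  | |- cp _ _ (fun x => chi (memP _ _)) => apply cp_memP
  | |- cp _ _ (fun x => chi (revP _ _)) => apply cp_revP
  end.

(* The number of points of [A] among the [2^N] zero-padded strings of length [N]. *)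
Definition cnt (N : nat) (A : nat -> Prop) : nat := bsum (2 ^ N) (fun u => chi (A u)).

(* [Phi e a c] stands for [a / 2^c < m(P ∩ cl e)]; the formula then says,
   through dyadic bounds, that [m (P Δ cl e) <= 2^-k]. *)
Definition distP (Phi : nat -> nat -> nat -> Prop) (e k : nat) : Prop :=
  exists e' c a1 a2, (forall u, memP u e <-> ~ memP u e') /\
    ~ Phi e' a1 c /\ (a2 = 0 \/ Phi e a2 c) /\
    a1 * 2 ^ (e + k) + cnt e (fun u => memP u e) * 2 ^ (c + k) <=
      a2 * 2 ^ (e + k) + 2 ^ (c + e).

(** Here [c] codes the first values of a function whose value at [t] pairs a code of [E_t] with the
    bound [h(t)]. A position is read in two ways: as the code of a sequence it selects a set, as a
    coordinate of the branch [s] it selects a bound. *)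
Definition hullP (u c : nat) : Prop :=
  exists s, (forall i, inb i s <-> inb i c) /\
    (forall i, inb i c -> nthc i s <= snd (Cantor.of_nat (nthc i c))) /\
    forall t, inb t c -> (forall i, inb i t -> inb i s /\ nthc i t = nthc i s) ->
      memP u (fst (Cantor.of_nat (nthc t c))).

(** [a / 2^b < m(cl e ∩ cl d)] with denominators cleared. The level [e + d] is large enough because
    a code exceeds the length of every string listed in it. *)
Definition leafP (e d a b : nat) : Prop :=
  a * 2 ^ (e + d) < cnt (e + d) (fun u => memP u e /\ memP u d) * 2 ^ b.

(** The negated answer makes [a1 / 2^c] an upper bound for [m(P ∩ D)]; the inequality compares
    [a / 2^b] with [m(D)] minus that bound. *)
Definition complP (Phi : nat -> nat -> nat -> Prop) (d a b : nat) : Prop :=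
  exists c a1, ~ Phi d a1 c /\
    a1 * 2 ^ (b + d) + a * 2 ^ (c + d) < cnt d (fun u => memP u d) * 2 ^ (c + b).

(** The tolerance is [2^-j]. The distances [2^-(j + t + 2)] add up to half of it, so a lower bound
    [a / 2^b + 2^-j] for the clopen scheme leaves more than [a / 2^b] for the given one. The level
    [d + fbar F n] suffices because [fbar F n] exceeds its entries, hence the codes of the sets in
    use. *)
Definition suslinP (Phi : nat -> nat -> nat -> nat -> Prop) (d a b : nat) : Prop :=
  exists j F, forall n,
    (forall t, inb t (fbar F n) ->
       distP (Phi t) (fst (Cantor.of_nat (nthc t (fbar F n)))) (j + t + 2)) /\
    (a * 2 ^ j + 2 ^ b) * 2 ^ (d + fbar F n) <
      cnt (d + fbar F n) (fun u => hullP u (fbar F n) /\ memP u d) * 2 ^ (b + j).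

Lemma cp_hullP {X} {fn : X -> nat -> nat} {ctx} u c :
  cp fn ctx u -> cp fn ctx c -> cp fn ctx (fun x => chi (hullP (u x) (c x))).
Proof. intros; unfold hullP; cpt. Qed.

Lemma cp_leafP {X} {fn : X -> nat -> nat} {ctx} e d a b :
  cp fn ctx e -> cp fn ctx d -> cp fn ctx a -> cp fn ctx b ->
  cp fn ctx (fun x => chi (leafP (e x) (d x) (a x) (b x))).
Proof. intros; unfold leafP, cnt; cpt. Qed.

(** * One step of the recursion *)

Record input := mkInput
  { self : nat; code : nat -> nat; node : list nat; clo : nat; num : nat; expo : nat }.

Definition calls (e : nat) (f : nat -> nat) (sigma : list nat)
    (Phi : nat -> nat -> nat -> Prop) : Prop :=
  forall d a b tl,
    Comp e (mkArgs (e :: seqcode (rev sigma) :: d :: a :: b :: tl) [f] [Sfun]) (chi (Phi d a b)).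

Definition label (i : input) : nat := code i (seqcode (node i)).

(** For each kind of node the type bundles the label with the convergence of the self-calls made
    there: none at a leaf, child 0 at a complement, every child at a Suslin node. *)
Definition leaf_input : Type :=
  { p : input * list nat | label (fst p) = seqcode (0 :: snd p) }.
Definition compl_input : Type :=
  { p : input * (nat -> nat -> nat -> Prop) | label (fst p) = seqcode [1] /\
      calls (self (fst p)) (code (fst p)) (node (fst p) ++ [0]) (snd p) }.
Definition suslin_input : Type :=
  { p : input * (nat -> nat -> nat -> nat -> Prop) | label (fst p) = seqcode [2] /\
      forall t, calls (self (fst p)) (code (fst p)) (node (fst p) ++ [t]) (snd p t) }.

Definition regs {X} (pi : X -> input) : list (X -> nat) :=
  [fun x => self (pi x); fun x => seqcode (rev (node (pi x)));
   fun x => clo (pi x); fun x => num (pi x); fun x => expo (pi x)].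

Lemma cp_selfcall {X} {fn : X -> nat -> nat} {ctx} (e d a b : X -> nat) sigma
    (Phi : X -> nat -> nat -> nat -> Prop) :
  (forall x, calls (e x) (fn x) (sigma x) (Phi x)) ->
  cp fn ctx e -> cp fn ctx (fun x => seqcode (rev (sigma x))) ->
  cp fn ctx d -> cp fn ctx a -> cp fn ctx b ->
  cp fn ctx (fun x => chi (Phi x (d x) (a x) (b x))).
Proof.
  intros H He Hs Hd Ha Hb.
  apply (cp_call [e; fun x => seqcode (rev (sigma x)); d; a; b] e);
    [exact He | repeat (constructor; [assumption|]); constructor |].
  intros x tl; apply H.
Qed.

Lemma cp_child {X} {fn : X -> nat -> nat} {ctx} (t : X -> nat) sigma :
  cp fn ctx t -> cp fn ctx (fun x => seqcode (rev (sigma x))) ->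
  cp fn ctx (fun x => seqcode (rev (sigma x ++ [t x]))).
Proof.
  intros Ht Hs; apply (cp_ext (fun x => S (Cantor.to_nat (t x, seqcode (rev (sigma x)))))).
  - intros x; now rewrite rev_app_distr.
  - now apply cp_S, cp_pair.
Qed.

(** The register holds the code of the reversed node, whereas [code] is queried at the node itself;
    the argument [y] is guessed and recognised by [revP]. *)
Lemma label_ex i (Q : nat -> Prop) :
  (exists y, revP y (seqcode (rev (node i))) /\ Q (code i y)) <-> Q (label i).
Proof.
  unfold label; split.
  - intros (y & Hy & H); apply revP_code in Hy; rewrite rev_involutive in Hy; now subst.
  - intros H; exists (seqcode (node i)); split; [|exact H].
    apply revP_code; now rewrite rev_involutive.
Qed.

Lemma cp_label {X} (pi : X -> input) (Q : X -> nat -> Prop) :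
  cp (fun p => code (pi (fst p))) (bind (regs pi)) (fun p => chi (Q (fst p) (snd p))) ->
  cp (fun x => code (pi x)) (regs pi) (fun x => chi (Q x (label (pi x)))).
Proof.
  intros HQ; eapply cp_pext; [intros x; apply (label_ex (pi x) (Q x))|]; cpt.
  apply (cp_inst (fn := fun x => code (pi x)) (fun x y => chi (Q x y)) (fun p => code (pi (fst p)) (snd p)) HQ).
  apply (cp_fn (fn := fun p => code (pi (fst p)))); cpv.
Qed.

Lemma cp_leaf : cp (fun x : leaf_input => code (fst (proj1_sig x)))
  (regs (fun x => fst (proj1_sig x)))
  (fun x => let '(i, cs) := proj1_sig x in chi (leafP (seqcode cs) (clo i) (num i) (expo i))).
Proof.
  eapply cp_ext; [|apply (cp_label (fun x : leaf_input => fst (proj1_sig x)) (fun x y =>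
    exists e, y = S (Cantor.to_nat (0, e)) /\
    leafP e (clo (fst (proj1_sig x))) (num (fst (proj1_sig x))) (expo (fst (proj1_sig x)))))].
  - intros [[i cs] H]; simpl in *; apply chi_iff; rewrite H, seqcode_cons; split.
    + intros (e & E & He); injection E as E.
      apply Cantor.to_nat_inj in E; injection E as <-; exact He.
    + intros He; now exists (seqcode cs).
  - cpt; apply cp_leafP; cpt.
Qed.

Lemma cp_compl : cp (fun x : compl_input => code (fst (proj1_sig x)))
  (regs (fun x => fst (proj1_sig x)))
  (fun x => let '(i, Phi) := proj1_sig x in chi (complP Phi (clo i) (num i) (expo i))).
Proof.
  apply (cp_ext (fun x : compl_input => chi (complP (snd (proj1_sig x)) (clo (fst (proj1_sig x)))
    (num (fst (proj1_sig x))) (expo (fst (proj1_sig x)))))).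
  { now intros [[i cs] H]. }
  unfold complP, cnt; cpt.
  apply (cp_selfcall (fun y => self (fst (proj1_sig (fst (fst y))))) _ _ _
    (fun y => node (fst (proj1_sig (fst (fst y)))) ++ [0])
    (fun y => snd (proj1_sig (fst (fst y))))); cpt.
  - intros [[[[i Phi] [H1 H2]] ?] ?]; exact H2.
  - apply cp_child; cpt.
Qed.

Lemma cp_suslin : cp (fun x : suslin_input => code (fst (proj1_sig x)))
  (regs (fun x => fst (proj1_sig x)))
  (fun x => let '(i, Phi) := proj1_sig x in chi (suslinP Phi (clo i) (num i) (expo i))).
Proof.
  apply (cp_ext (fun x : suslin_input => chi (suslinP (snd (proj1_sig x)) (clo (fst (proj1_sig x)))
    (num (fst (proj1_sig x))) (expo (fst (proj1_sig x)))))).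
  { now intros [[i cs] H]. }
  unfold suslinP, cnt; apply cp_ex.
  apply (cp_Suslin (fun p c => (forall t, inb t c ->
       distP (snd (proj1_sig (fst p)) t) (fst (Cantor.of_nat (nthc t c))) (snd p + t + 2)) /\
    (num (fst (proj1_sig (fst p))) * 2 ^ snd p + 2 ^ expo (fst (proj1_sig (fst p)))) *
       2 ^ (clo (fst (proj1_sig (fst p))) + c) <
      bsum (2 ^ (clo (fst (proj1_sig (fst p))) + c)) (fun u => chi (hullP u c /\ memP u (clo (fst (proj1_sig (fst p)))))) *
      2 ^ (expo (fst (proj1_sig (fst p))) + snd p))).
  unfold distP, cnt; cpt.
  3: apply cp_hullP; cpt.
  (* Seven numbers are bound at this point, in the order [j], the code of the first values of [F],
     [t], [e'], [c], [a1], [a2]. Hence the input lies under seven [fst], and [t] is found below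
     four. *)
  all: apply (cp_selfcall (fun y => self (fst (proj1_sig (fst (fst (fst (fst (fst (fst (fst y))))))))))
         _ _ _
         (fun y => node (fst (proj1_sig (fst (fst (fst (fst (fst (fst (fst y)))))))))
            ++ [snd (fst (fst (fst (fst y))))])
         (fun y => snd (proj1_sig (fst (fst (fst (fst (fst (fst (fst y))))))))
            (snd (fst (fst (fst (fst y))))))); try solve [cpt];
    [intros [[[[[[[[[i Phi] [H1 H2]] ?] ?] t] ?] ?] ?] ?]; apply H2 | apply cp_child; cpt].
Qed.

(** The label is examined by tests that make no self-call, and then only the index for that kind of
    node runs. The index [e] to be called stays arbitrary here, so that it can be identified with
    [T] afterwards. *)
Lemma step_index : exists T,
  (forall e f sigma cs, f (seqcode sigma) = seqcode (0 :: cs) ->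
     forall d a b tl,
     Comp T (mkArgs (e :: seqcode (rev sigma) :: d :: a :: b :: tl) [f] [Sfun])
       (chi (leafP (seqcode cs) d a b))) /\
  (forall e f sigma Phi, f (seqcode sigma) = seqcode [1] -> calls e f (sigma ++ [0]) Phi ->
     forall d a b tl,
     Comp T (mkArgs (e :: seqcode (rev sigma) :: d :: a :: b :: tl) [f] [Sfun])
       (chi (complP Phi d a b))) /\
  (forall e f sigma Phi, f (seqcode sigma) = seqcode [2] ->
     (forall t, calls e f (sigma ++ [t]) (Phi t)) ->
     forall d a b tl,
     Comp T (mkArgs (e :: seqcode (rev sigma) :: d :: a :: b :: tl) [f] [Sfun])
       (chi (suslinP Phi d a b))).
Proof.
  set (pi2 := fun z : compl_input + suslin_input =>
    match z with inl x => fst (proj1_sig x) | inr x => fst (proj1_sig x) end).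
  set (pi := fun z : leaf_input + (compl_input + suslin_input) =>
    match z with inl x => fst (proj1_sig x) | inr x => pi2 x end).
  assert (H : cp (fun z => code (pi z)) (regs pi) (fun z => match z with
    | inl x => let '(i, cs) := proj1_sig x in chi (leafP (seqcode cs) (clo i) (num i) (expo i))
    | inr (inl x) => let '(i, Phi) := proj1_sig x in chi (complP Phi (clo i) (num i) (expo i))
    | inr (inr x) => let '(i, Phi) := proj1_sig x in chi (suslinP Phi (clo i) (num i) (expo i))
    end)).
  { apply (cp_case _ _ _ (fun z => exists e, label (pi z) = S (Cantor.to_nat (0, e)))).
    - intros [[i cs] Hx]; exists (seqcode cs); exact Hx.
    - intros [[[i Phi] [Hx Hc]]|[[i Phi] [Hx Hc]]] [e He]; simpl in *; rewrite Hx, seqcode_cons in He;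
        injection He as E; apply Cantor.to_nat_inj in E; discriminate E.
    - apply (cp_label pi (fun z y => exists e, y = S (Cantor.to_nat (0, e)))); cpt.
    - exact cp_leaf.
    - apply (cp_case (fun y => code (pi2 y)) (regs pi2) _ (fun z => label (pi2 z) = seqcode [1])).
      + intros [[i Phi] [Hx Hc]]; exact Hx.
      + intros [[i Phi] [Hx Hc]] E; simpl in *; rewrite Hx in E.
        apply seqcode_inj in E; discriminate E.
      + apply (cp_label pi2 (fun z y => y = seqcode [1])); cpt.
      + exact cp_compl.
      + exact cp_suslin. }
  destruct H as [T HT]; exists T; split; [|split].
  - intros e f sigma cs Hl d a b tl.
    exact (HT (inl (exist _ (mkInput e f sigma d a b, cs) Hl)) tl).
  - intros e f sigma Phi Hl Hc d a b tl.
    exact (HT (inr (inl (exist _ (mkInput e f sigma d a b, Phi) (conj Hl Hc)))) tl).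
  - intros e f sigma Phi Hl Hc d a b tl.
    exact (HT (inr (inr (exist _ (mkInput e f sigma d a b, Phi) (conj Hl Hc)))) tl).
Qed.

(** * Clopen sets *)

Lemma bsum_app n m g : bsum (n + m) g = bsum n g + bsum m (fun k => g (n + k)).
Proof.
  induction m as [|m IH]; simpl; [now rewrite !Nat.add_0_r|].
  rewrite Nat.add_succ_r; simpl; lia.
Qed.

Lemma bsum_add n g h : bsum n (fun k => g k + h k) = bsum n g + bsum n h.
Proof. induction n; simpl; lia. Qed.

Lemma bsum_le n g h : (forall k, k < n -> g k <= h k) -> bsum n g <= bsum n h.
Proof.
  induction n as [|n IH]; simpl; intros H; [lia|].
  apply Nat.add_le_mono; [apply IH; auto | auto].
Qed.

Lemma bsum_one n : bsum n (fun _ => 1) = n.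
Proof. induction n; simpl; lia. Qed.

Lemma chi_le P Q : (P -> Q) -> chi P <= chi Q.
Proof. unfold chi; repeat destruct excluded_middle_informative; try lia; tauto. Qed.

(** * Dependent choice and König's lemma *)

Lemma dependent_choice (G : list nat -> Prop) (Q : list nat -> nat -> Prop) :
  G [] -> (forall s, G s -> exists j, Q s j /\ G (s ++ [j])) ->
  exists g, forall n, G (map g (seq 0 n)) /\ Q (map g (seq 0 n)) (g n).
Proof.
  intros G0 GS.
  set (next s := epsilon (inhabits 0) (fun j => Q s j /\ G (s ++ [j]))).
  set (l := nat_rect (fun _ => list nat) [] (fun _ s => s ++ [next s])).
  exists (fun n => next (l n)).
  assert (E : forall n, map (fun n => next (l n)) (seq 0 n) = l n).
  { induction n as [|n IH]; [reflexivity|].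
    rewrite seq_S, map_app, IH; reflexivity. }
  assert (H : forall n, G (l n)).
  { induction n as [|n IH]; [exact G0|].
    exact (proj2 (epsilon_spec (inhabits 0) (fun j => Q (l n) j /\ G (l n ++ [j])) (GS _ IH))). }
  intros n; rewrite E; split; [apply H|].
  exact (proj1 (epsilon_spec (inhabits 0) (fun j => Q (l n) j /\ G (l n ++ [j])) (GS _ (H n)))).
Qed.

Lemma bounded_witness (P : nat -> nat -> Prop) :
  (forall i n m, n <= m -> P i n -> P i m) -> forall b, (forall i, i < b -> exists n, P i n) ->
  exists n, forall i, i < b -> P i n.
Proof.
  intros Hm b; induction b as [|b IH]; intros H; [exists 0; lia|].
  destruct IH as [n Hn]; [auto|]; destruct (H b) as [m Hb]; [lia|].
  exists (max n m); intros i Hi; destruct (Nat.eq_dec i b) as [->|h].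
  - apply (Hm b m); [lia | exact Hb].
  - apply (Hm i n); [lia | apply Hn; lia].
Qed.

Lemma konig (h : nat -> nat) (T : list nat -> Prop) :
  (forall s t, T (s ++ t) -> T s) ->
  (forall n, exists s, length s = n /\ T s /\ forall i, i < n -> nth i s 0 <= h i) ->
  exists g, (forall i, g i <= h i) /\ forall n, T (map g (seq 0 n)).
Proof.
  intros HT Hex.
  (* König's invariant: [s] has bounded extensions in [T] of every length. *)
  set (G s := forall n, exists t, length t = n /\ T (s ++ t) /\
    forall i, i < n -> nth i t 0 <= h (length s + i)).
  destruct (dependent_choice G (fun s j => j <= h (length s))) as [g Hg].
  - intros n; destruct (Hex n) as (s & H1 & H2 & H3); exists s; auto.
  - intros s Hs; apply NNPP; intros Hno.
    (* If every admissible [j] failed at some length, a single [N] would serve for all of them,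
       since failure persists at larger lengths. An extension of [s] by [S N] entries refutes
       this. *)
    destruct (bounded_witness (fun j n => ~ exists t, length t = n /\ T ((s ++ [j]) ++ t) /\
      forall i, i < n -> nth i t 0 <= h (length (s ++ [j]) + i)) ) with (b := S (h (length s)))
      as [N HN].
    + intros j n m Hnm Hn (t & L & Ht & Hb); apply Hn; exists (firstn n t).
      split; [rewrite length_firstn; lia|]; split.
      * apply (HT _ (skipn n t)); rewrite <- app_assoc, firstn_skipn; exact Ht.
      * intros i Hi; rewrite nth_firstn.
        destruct (Nat.ltb_spec i n); [apply Hb; lia | lia].
    + intros j Hj; apply not_all_ex_not; intros HG; apply Hno; exists j.
      split; [lia|]; intros n; exact (HG n).
    + destruct (Hs (S N)) as ([|j t] & L & Ht & Hb); [discriminate L|].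
      injection L as L; apply (HN j).
      * specialize (Hb 0); simpl in Hb; rewrite Nat.add_0_r in Hb; lia.
      * exists t; split; [exact L|]; rewrite <- app_assoc; split; [exact Ht|].
        intros i Hi; rewrite length_app; simpl length.
        specialize (Hb (S i)); simpl nth in Hb.
        replace (length s + 1 + i) with (length s + S i) by lia; apply Hb; lia.
  - exists g; split.
    + intros i; destruct (Hg i) as [_ H]; now rewrite length_map, length_seq in H.
    + intros n; destruct (Hg n) as [H _]; destruct (H 0) as (t & _ & Ht & _); exact (HT _ _ Ht).
Qed.

(** * Clopen sets and their measure by counting *)

Definition pt (u : nat) : Cspace := Nat.testbit u.
Definition lev (N : nat) (A : Cspace -> Prop) : Prop :=
  forall x y, (forall i, i < N -> x i = y i) -> A x -> A y.
Definition clopen (A : Cspace -> Prop) : Prop := exists N, lev N A.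

Definition cup (A B : Cspace -> Prop) x := A x \/ B x.
Definition cap (A B : Cspace -> Prop) x := A x /\ B x.
Definition diff (A B : Cspace -> Prop) x := A x /\ ~ B x.

Lemma lev_le N M A : N <= M -> lev N A -> lev M A.
Proof. intros H HA x y E; apply HA; intros i Hi; apply E; lia. Qed.

Lemma lev_cup N A B : lev N A -> lev N B -> lev N (cup A B).
Proof. intros HA HB x y E [H|H]; [left; now apply (HA x) | right; now apply (HB x)]. Qed.

Lemma lev_cap N A B : lev N A -> lev N B -> lev N (cap A B).
Proof. intros HA HB x y E [H H']; split; [now apply (HA x) | now apply (HB x)]. Qed.

Lemma lev_diff N A B : lev N A -> lev N B -> lev N (diff A B).
Proof.
  intros HA HB x y E [H H']; split; [now apply (HA x)|].
  intros h; apply H'; apply (HB y); [intros i Hi; symmetry; now apply E | exact h].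
Qed.

Lemma clopen_common A B : clopen A -> clopen B -> exists N, lev N A /\ lev N B.
Proof.
  intros [N HN] [M HM]; exists (max N M).
  split; [apply (lev_le N) | apply (lev_le M)]; auto; lia.
Qed.

Lemma clopen_cup A B : clopen A -> clopen B -> clopen (cup A B).
Proof. intros HA HB; destruct (clopen_common A B) as (N & ? & ?); auto; exists N; now apply lev_cup. Qed.

Lemma clopen_cap A B : clopen A -> clopen B -> clopen (cap A B).
Proof. intros HA HB; destruct (clopen_common A B) as (N & ? & ?); auto; exists N; now apply lev_cap. Qed.

Lemma clopen_diff A B : clopen A -> clopen B -> clopen (diff A B).
Proof. intros HA HB; destruct (clopen_common A B) as (N & ? & ?); auto; exists N; now apply lev_diff. Qed.

Lemma clopen_const P : clopen (fun _ => P).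
Proof. exists 0; intros x y _ H; exact H. Qed.

Lemma clopen_bounded_cup (U : nat -> Cspace -> Prop) n :
  (forall i, i < n -> clopen (U i)) -> clopen (fun x => exists i, i < n /\ U i x).
Proof.
  intros H.
  destruct (bounded_witness (fun i N => lev N (U i))) with (b := n) as [N HN]; auto.
  - intros i N M HNM; now apply lev_le.
  - exists N; intros x y E (i & Hi & Hx); exists i; split; [exact Hi|].
    now apply (HN i Hi x).
Qed.

Lemma clopen_iff A B : (forall x, A x <-> B x) -> clopen A -> clopen B.
Proof. intros H [N HN]; exists N; intros x y E Hx; apply H, (HN x), H; auto. Qed.

Lemma pt_low N u i : (i < N)%nat -> pt (2 ^ N + u) i = pt u i.
Proof.
  intros Hi; unfold pt.
  rewrite <- (Nat.mod_pow2_bits_low _ N i Hi), <- (Nat.mod_pow2_bits_low u N i Hi).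
  f_equal; rewrite <- (Nat.Div0.mod_add u 1); f_equal; lia.
Qed.

(* [lev N A] makes [A] a union of cylinders of length [N], counted on their
   zero-padded representatives. *)
Lemma cnt_S N A : lev N A -> cnt (S N) (fun u => A (pt u)) = 2 * cnt N (fun u => A (pt u)).
Proof.
  intros H; unfold cnt; replace (2 ^ S N) with (2 ^ N + 2 ^ N) by (simpl; lia).
  rewrite bsum_app; replace (2 * _) with (bsum (2 ^ N) (fun u => chi (A (pt u))) +
    bsum (2 ^ N) (fun u => chi (A (pt u)))) by lia.
  f_equal; apply bsum_ext; intros u _; apply chi_iff.
  split; apply H; intros i Hi; [|symmetry]; now apply pt_low.
Qed.

Open Scope R_scope.

Definition mcN (N : nat) (A : Cspace -> Prop) : R :=
  INR (cnt N (fun u => A (pt u))) / 2 ^ N.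
Definition mc (A : Cspace -> Prop) : R := mcN (epsilon (inhabits 0%nat) (fun N => lev N A)) A.

Lemma pow2_pos n : 0 < 2 ^ n.
Proof. apply pow_lt; lra. Qed.

Lemma mcN_le N M A : (N <= M)%nat -> lev N A -> mcN M A = mcN N A.
Proof.
  intros H HA; induction H as [|M HM IH]; [reflexivity|].
  rewrite <- IH; unfold mcN; rewrite cnt_S by now apply (lev_le N).
  rewrite mult_INR; simpl; field; apply Rgt_not_eq, pow2_pos.
Qed.

Lemma mcE N A : lev N A -> mc A = mcN N A.
Proof.
  intros H; unfold mc; set (M := epsilon _ _).
  assert (HM : lev M A) by (apply (epsilon_spec (inhabits 0%nat) (fun N => lev N A)); now exists N).
  rewrite <- (mcN_le N (max N M)), <- (mcN_le M (max N M)); auto; lia.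
Qed.

Lemma mc_mono A B : clopen A -> clopen B -> (forall x, A x -> B x) -> mc A <= mc B.
Proof.
  intros HA HB H; destruct (clopen_common A B HA HB) as (N & LA & LB).
  rewrite (mcE N A LA), (mcE N B LB); unfold mcN, Rdiv.
  apply Rmult_le_compat_r; [left; apply Rinv_0_lt_compat, pow2_pos|].
  apply le_INR, bsum_le; intros; now apply chi_le, H.
Qed.

Lemma mc_ext A B : clopen A -> (forall x, A x <-> B x) -> mc A = mc B.
Proof.
  intros HA H; assert (HB := clopen_iff A B H HA).
  apply Rle_antisym; apply mc_mono; firstorder.
Qed.

Lemma mc_modular A B : clopen A -> clopen B -> mc (cup A B) + mc (cap A B) = mc A + mc B.
Proof.
  intros HA HB; destruct (clopen_common A B HA HB) as (N & LA & LB).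
  rewrite (mcE N A LA), (mcE N B LB), (mcE N _ (lev_cup _ _ _ LA LB)), (mcE N _ (lev_cap _ _ _ LA LB)).
  unfold mcN, Rdiv; rewrite <- !Rmult_plus_distr_r, <- !plus_INR; do 2 f_equal.
  unfold cnt; rewrite <- !bsum_add; apply bsum_ext; intros u _; unfold cup, cap, chi.
  repeat destruct excluded_middle_informative; tauto.
Qed.

Lemma mc_bounds A : clopen A -> 0 <= mc A <= 1.
Proof.
  intros [N HN]; rewrite (mcE N A HN); unfold mcN; pose proof (pow2_pos N) as P.
  assert (H : (cnt N (fun u => A (pt u)) <= 2 ^ N)%nat).
  { apply Nat.le_trans with (bsum (2 ^ N) (fun _ => 1%nat)); [|now rewrite bsum_one].
    apply bsum_le; intros k _; unfold chi; destruct excluded_middle_informative; lia. }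
  apply le_INR in H; rewrite pow_INR in H; change (INR 2) with 2 in H.
  split; [apply Rle_mult_inv_pos; auto using pos_INR|].
  apply (Rmult_le_reg_r (2 ^ N)); [exact P|].
  unfold Rdiv; rewrite Rmult_assoc, Rinv_l by lra; lra.
Qed.

Lemma mc_empty A : (forall x, ~ A x) -> mc A = 0.
Proof.
  intros H; rewrite (mcE 0 A) by (intros x y _ h; now destruct (H x)).
  unfold mcN, cnt; simpl; rewrite chi_false by apply H; simpl; field.
Qed.

Lemma mc_full A : (forall x, A x) -> mc A = 1.
Proof.
  intros H; rewrite (mcE 0 A) by (intros x y _ h; apply H).
  unfold mcN, cnt; simpl; rewrite chi_true by apply H; simpl; field.
Qed.

Lemma mc_diff A B : clopen A -> clopen B -> mc (diff A B) + mc (cap A B) = mc A.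
Proof.
  intros HA HB.
  rewrite <- mc_modular by auto using clopen_diff, clopen_cap.
  rewrite (mc_empty (cap (diff A B) _)) by (unfold cap, diff; tauto).
  rewrite Rplus_0_r; symmetry; apply mc_ext; [exact HA|].
  intros x; unfold cup, cap, diff; destruct (classic (B x)); tauto.
Qed.

(** König's lemma for the tree of binary strings that begin some point of [K n], with [n] the length
    of the string. *)
Lemma compactness (K : nat -> Cspace -> Prop) :
  (forall n, clopen (K n)) -> (forall n m x, (n <= m)%nat -> K m x -> K n x) ->
  (forall n, exists x, K n x) -> exists x, forall n, K n x.
Proof.
  intros Hc Hd Hn.
  set (bit n := negb (Nat.eqb n 0)).
  destruct (konig (fun _ => 1%nat) (fun s => exists x, K (length s) x /\
    forall i, (i < length s)%nat -> x i = bit (nth i s 0%nat))) as (g & _ & Hg).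
  - intros s t (x & Hx & E); rewrite length_app in *; exists x; split.
    + apply (Hd _ (length s + length t)%nat); [lia | exact Hx].
    + intros i Hi; rewrite E by lia; now rewrite app_nth1.
  - intros n; destruct (Hn n) as [x Hx].
    exists (map (fun i => if x i then 1%nat else 0%nat) (seq 0 n)).
    assert (E : forall i, (i < n)%nat ->
      nth i (map (fun i => if x i then 1%nat else 0%nat) (seq 0 n)) 0%nat =
      if x i then 1%nat else 0%nat).
    { intros i Hi; rewrite nth_indep with (d' := if x 0%nat then 1%nat else 0%nat) by
        now rewrite length_map, length_seq.
      rewrite (map_nth (fun i => if x i then 1%nat else 0%nat)), seq_nth; auto. }
    rewrite length_map, length_seq; repeat split.
    + exists x; split; [exact Hx|]; intros i Hi; rewrite E by exact Hi; now destruct (x i).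
    + intros i Hi; rewrite E by exact Hi; destruct (x i); lia.
  - exists (fun i => bit (g i)); intros n.
    destruct (Hc n) as [N HN].
    (* At this depth the string begins a point of [K n], and agreement on [N] coordinates carries
       membership over to the branch. *)
    destruct (Hg (max n N)) as (x & Hx & E); rewrite length_map, length_seq in *.
    apply (HN x); [|apply (Hd _ (max n N)); [lia | exact Hx]].
    intros i Hi; rewrite E by lia; f_equal.
    rewrite nth_indep with (d' := g 0%nat) by (rewrite length_map, length_seq; lia).
    rewrite map_nth, seq_nth by lia; reflexivity.
Qed.

(** * Outer measure *)

(* [A] has an open superset of measure at most [r]. *)
Definition leq (A : Cspace -> Prop) (r : R) : Prop :=
  exists U : nat -> Cspace -> Prop, (forall n, clopen (U n)) /\
    (forall n m x, (n <= m)%nat -> U n x -> U m x) /\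
    (forall n, mc (U n) <= r) /\ forall x, A x -> exists n, U n x.

Definition is_outer (A : Cspace -> Prop) (m : R) : Prop :=
  (forall r, leq A r -> m <= r) /\ (forall r, m < r -> leq A r).

Lemma is_outer_ex A : exists m, is_outer A m.
Proof.
  (* [completeness] yields suprema, so the infimum is obtained by negation. *)
  destruct (completeness (fun y => leq A (- y))) as [m [Hub Hl]].
  - exists 0; intros y (U & Hc & _ & Hr & _).
    pose proof (Hr 0%nat); pose proof (mc_bounds _ (Hc 0%nat)); lra.
  - exists (-1), (fun _ _ => True); split; [intros _; apply clopen_const|].
    split; [auto|]; split; [|intros x _; now exists 0%nat].
    intros _; rewrite mc_full by auto; lra.
  - exists (- m); split.
    + intros r Hr; enough (- r <= m) by lra; apply Hub; now rewrite Ropp_involutive.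
    + intros r Hr; apply NNPP; intros Hn.
      enough (m <= - r) by lra; apply Hl; intros y (U & Hc & Hi & HU & Hcov).
      apply Rnot_lt_le; intros Hy; apply Hn; exists U; repeat split; auto.
      intros n; specialize (HU n); lra.
Qed.

Definition mu (A : Cspace -> Prop) : R := epsilon (inhabits 0) (is_outer A).

Lemma mu_le A r : leq A r -> mu A <= r.
Proof. apply (proj1 (epsilon_spec (inhabits 0) (is_outer A) (is_outer_ex A))). Qed.

Lemma mu_lt A r : mu A < r -> leq A r.
Proof. apply (proj2 (epsilon_spec (inhabits 0) (is_outer A) (is_outer_ex A))). Qed.

Lemma leq_pos A r : leq A r -> 0 <= r.
Proof.
  intros (U & Hc & _ & Hr & _).
  pose proof (Hr 0%nat); pose proof (mc_bounds _ (Hc 0%nat)); lra.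
Qed.

Lemma mu_pos A : 0 <= mu A.
Proof.
  apply Rnot_lt_le; intros H.
  assert (h : leq A (mu A / 2)) by (apply mu_lt; lra); apply leq_pos in h; lra.
Qed.

Lemma le_of_leq (a : R) A : (forall r, leq A r -> a <= r) -> a <= mu A.
Proof.
  intros H; apply Rnot_lt_le; intros h.
  enough (a <= (a + mu A) / 2) by lra; apply H, mu_lt; lra.
Qed.

Lemma mu_mono A B : (forall x, A x -> B x) -> mu A <= mu B.
Proof.
  intros H; apply le_of_leq; intros r (U & ? & ? & ? & Hcov); apply mu_le.
  exists U; repeat split; auto.
Qed.

Lemma mu_ext A B : (forall x, A x <-> B x) -> mu A = mu B.
Proof. intros H; apply Rle_antisym; apply mu_mono; firstorder. Qed.

(** By compactness an open set containing the intersection of the [K n] already contains one of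
    them, so its measure is at least [q]. The lower bounds for Suslin sets come from here. *)
Lemma mu_inter_ge (K : nat -> Cspace -> Prop) A q :
  (forall n, clopen (K n)) -> (forall n m x, (n <= m)%nat -> K m x -> K n x) ->
  (forall n, q <= mc (K n)) -> (forall x, (forall n, K n x) -> A x) -> q <= mu A.
Proof.
  intros Hc Hd Hq HA; apply le_of_leq; intros r (U & HU & Hi & Hr & Hcov).
  apply NNPP; intros Hn.
  destruct (compactness (fun n => diff (K n) (U n))) as [x Hx].
  - intros n; now apply clopen_diff.
  - intros n m x Hnm [H1 H2]; split; [now apply (Hd n m)|].
    intros h; apply H2; now apply (Hi n m).
  - intros n; apply NNPP; intros Hno; apply Hn.
    apply Rle_trans with (mc (K n)); [apply Hq|].
    apply Rle_trans with (mc (U n)); [|apply Hr].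
    apply mc_mono; auto; intros x Hx; apply NNPP; intros h; apply Hno; now exists x.
  - destruct (Hcov x) as [n Hn']; [apply HA; intros n; apply (Hx n)|].
    now apply (Hx n).
Qed.

Lemma mu_open_le (U : nat -> Cspace -> Prop) A r :
  (forall n, clopen (U n)) -> (forall n m x, (n <= m)%nat -> U n x -> U m x) ->
  (forall n, mc (U n) <= r) -> (forall x, A x -> exists n, U n x) -> mu A <= r.
Proof. intros; apply mu_le; now exists U. Qed.

Lemma mu_clopen A : clopen A -> mu A = mc A.
Proof.
  intros H; apply Rle_antisym.
  - apply (mu_open_le (fun _ => A)); auto using Rle_refl; now exists 0%nat.
  - apply (mu_inter_ge (fun _ => A)); auto using Rle_refl; intros x h; exact (h 0%nat).
Qed.

(** The open sets around [A] and [B] both contain [C], so their intersection has measure above [t]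
    at some finite stage [m]; from there on, modularity of clopen measure bounds the union. *)
Lemma leq_strong_subadd A B C r s t :
  leq A r -> leq B s -> (forall x, C x -> A x /\ B x) -> t < mu C ->
  leq (cup A B) (r + s - t).
Proof.
  intros (U & HU & Ui & Ur & Uc) (V & HV & Vi & Vs & Vc) HC Ht.
  exists (fun n => cup (U n) (V n)); repeat split.
  - intros n; now apply clopen_cup.
  - intros n m x Hnm [h|h]; [left; now apply (Ui n) | right; now apply (Vi n)].
  - assert (exists m, t < mc (cap (U m) (V m))) as [m Hm].
    { apply NNPP; intros Hn; apply (Rlt_not_le _ _ Ht), (mu_open_le (fun n => cap (U n) (V n))).
      - intros n; now apply clopen_cap.
      - intros n m x Hnm [h h']; split; [now apply (Ui n) | now apply (Vi n)].
      - intros n; apply Rnot_lt_le; intros h; apply Hn; now exists n.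
      - intros x Hx; destruct (HC x Hx) as [hA hB].
        destruct (Uc x hA) as [i Hi], (Vc x hB) as [j Hj]; exists (max i j).
        split; [apply (Ui i) | apply (Vi j)]; auto; lia. }
    intros n; set (k := max n m).
    apply Rle_trans with (mc (cup (U k) (V k))).
    { apply mc_mono; auto using clopen_cup.
      intros x [h|h]; [left; apply (Ui n) | right; apply (Vi n)]; auto; lia. }
    pose proof (mc_modular (U k) (V k) (HU k) (HV k)).
    assert (mc (cap (U m) (V m)) <= mc (cap (U k) (V k))).
    { apply mc_mono; auto using clopen_cap.
      intros x [h h']; split; [apply (Ui m) | apply (Vi m)]; auto; lia. }
    pose proof (Ur k); pose proof (Vs k); lra.
  - intros x [h|h]; [destruct (Uc x h) as [n Hn] | destruct (Vc x h) as [n Hn]];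
      exists n; [now left | now right].
Qed.

Lemma mu_strong_subadd A B : mu (cup A B) + mu (cap A B) <= mu A + mu B.
Proof.
  apply Rnot_lt_le; intros h.
  set (eps := (mu (cup A B) + mu (cap A B) - mu A - mu B) / 4).
  assert (H : leq (cup A B) (mu A + eps + (mu B + eps) - (mu (cap A B) - eps))).
  { apply (leq_strong_subadd A B (cap A B)); try apply mu_lt; unfold eps; try lra; auto. }
  apply mu_le in H; unfold eps in *; lra.
Qed.

Lemma mu_subadd A B : mu (cup A B) <= mu A + mu B.
Proof. pose proof (mu_strong_subadd A B); pose proof (mu_pos (cap A B)); lra. Qed.

(* Outer measure is continuous along increasing unions of arbitrary sets: if the open
   sets [U i] exceed [mu (B i)] by [eps / 2^(i+1)], strong subadditivity shows that
   [U 0 ∪ ... ∪ U n] exceeds [mu (B n)] by less than [eps]. *)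
Lemma mu_increasing (B : nat -> Cspace -> Prop) r :
  (forall n m x, (n <= m)%nat -> B n x -> B m x) -> (forall n, mu (B n) <= r) ->
  mu (fun x => exists n, B n x) <= r.
Proof.
  intros Bi Br; apply Rnot_lt_le; intros Hlt.
  set (eps := (mu (fun x => exists n, B n x) - r) / 2).
  assert (He : 0 < eps) by (unfold eps; lra).
  destruct (choice (fun i U => (forall n, clopen (U n)) /\
    (forall n m x, (n <= m)%nat -> U n x -> U m x) /\
    (forall n, mc (U n) <= mu (B i) + eps * (/ 2) ^ (S i)) /\
    forall x, B i x -> exists n, U n x)) as [U HU].
  { intros i; apply mu_lt.
    assert (0 < eps * (/ 2) ^ S i) by (apply Rmult_lt_0_compat, pow_lt; lra); lra. }
  set (W j n x := exists i, (i < S j)%nat /\ U i n x).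
  assert (Wc : forall j n, clopen (W j n)).
  { intros j n; apply clopen_bounded_cup; intros i _; apply HU. }
  assert (Wi : forall j n m x, (n <= m)%nat -> W j n x -> W j m x).
  { intros j n m x Hnm (i & Hi & Hx); exists i; split; [exact Hi|].
    now apply (proj1 (proj2 (HU i)) n m). }
  assert (Wr : forall j n, mc (W j n) <= mu (B j) + eps * (1 - (/ 2) ^ S j)).
  { induction j as [|j IH]; intros n.
    - rewrite (mc_ext _ (U 0%nat n)); [|apply Wc|].
      + pose proof (proj1 (proj2 (proj2 (HU 0%nat))) n); simpl in *; lra.
      + intros x; split; [intros (i & Hi & Hx) | intros Hx; exists 0%nat; auto].
        now replace i with 0%nat in Hx by lia.
    - apply Rnot_lt_le; intros Hn.
      (* [d] is the supposed excess. Strong subadditivity over [B j], which lies in both open sets,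
         bounds the union; half of [d] pays for the strict inequality it requires, and the other
         half gives the contradiction. *)
      set (d := mc (W (S j) n) - (mu (B (S j)) + eps * (1 - (/ 2) ^ S (S j)))).
      assert (H : leq (cup (fun x => exists n, W j n x) (fun x => exists n, U (S j) n x))
        (mu (B j) + eps * (1 - (/ 2) ^ S j) + (mu (B (S j)) + eps * (/ 2) ^ S (S j))
          - (mu (B j) - d / 2))).
      { apply (leq_strong_subadd _ _ (B j)).
        - exists (W j); split; [apply Wc|]; split; [apply Wi|]; split; [exact IH | auto].
        - exists (U (S j)); destruct (HU (S j)) as (? & ? & ? & ?); auto.
        - intros x Hx; split.
          + destruct (proj2 (proj2 (proj2 (HU j))) x Hx) as [m Hm].
            exists m, j; auto.
          + apply HU, (Bi j); auto.
        - unfold d; lra. }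
      apply mu_le in H.
      assert (H1 : mc (W (S j) n) <= mu (cup (fun x => exists n, W j n x) (fun x => exists n, U (S j) n x))).
      { rewrite <- mu_clopen by apply Wc; apply mu_mono.
        intros x (i & Hi & Hx); destruct (Nat.eq_dec i (S j)) as [->|h].
        - right; now exists n.
        - left; exists n, i; split; [lia | exact Hx]. }
      unfold d in *; simpl in *; lra. }
  enough (mu (fun x => exists n, B n x) <= r + eps) by (unfold eps in *; lra).
  (* The diagonal is increasing and exhausts every [U i], so it presents one open set around the
     whole union. *)
  apply (mu_open_le (fun n => W n n)).
  - intros n; apply Wc.
  - intros n m x Hnm (i & Hi & Hx); exists i; split; [lia|].
    now apply (proj1 (proj2 (HU i)) n m).
  - intros n; pose proof (Wr n n); pose proof (Br n).
    assert (0 < (/ 2) ^ S n) by (apply pow_lt; lra).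
    assert (0 < eps * (/ 2) ^ S n) by (now apply Rmult_lt_0_compat); lra.
  - intros x (i & Hx); destruct (proj2 (proj2 (proj2 (HU i))) x Hx) as [n Hn].
    exists (max i n), i; split; [lia|].
    apply (proj1 (proj2 (HU i)) n); [lia | exact Hn].
Qed.

Lemma mu_countable (A : nat -> Cspace -> Prop) (w : nat -> R) r :
  (forall n, mu (A n) <= w n) -> (forall n, sum_f_R0 w n <= r) ->
  mu (fun x => exists n, A n x) <= r.
Proof.
  intros HA Hw.
  apply Rle_trans with (mu (fun x => exists n i, (i <= n)%nat /\ A i x)).
  { apply mu_mono; intros x [n Hn]; exists n, n; auto. }
  apply (mu_increasing (fun n x => exists i, (i <= n)%nat /\ A i x)).
  - intros n m x Hnm (i & Hi & Hx); exists i; split; [lia | exact Hx].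
  - intros n; apply Rle_trans with (sum_f_R0 w n); [|apply Hw].
    induction n as [|n IH]; simpl.
    + eapply Rle_trans; [|apply (HA 0%nat)]; apply mu_mono.
      intros x (i & Hi & Hx); now replace i with 0%nat in Hx by lia.
    + eapply Rle_trans; [|apply Rplus_le_compat; [apply IH | apply (HA (S n))]].
      eapply Rle_trans; [|apply mu_subadd]; apply mu_mono.
      intros x (i & Hi & Hx); destruct (Nat.eq_dec i (S n)) as [->|h]; [now right|].
      left; exists i; split; [lia | exact Hx].
Qed.

(** Clopen sets satisfy Carathéodory's criterion, because [D] cuts an open set around [A] into two
    open sets. *)
Lemma mu_split A D : clopen D -> mu (cap A D) + mu (diff A D) = mu A.
Proof.
  intros HD; apply Rle_antisym.
  - apply le_of_leq; intros r (U & HU & Ui & Ur & Uc).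
    enough (mu (cap A D) <= r - mu (diff A D)) by lra.
    apply (mu_open_le (fun n => cap (U n) D)).
    + intros n; now apply clopen_cap.
    + intros n m x Hnm [h h']; split; [now apply (Ui n) | exact h'].
    (* The stage inside [D] is fixed while the one outside runs on; [max n k] puts both into one
       clopen set of measure at most [r]. *)
    + intros n; enough (mu (diff A D) <= r - mc (cap (U n) D)) by lra.
      apply (mu_open_le (fun k => diff (U (max n k)) D)).
      * intros k; now apply clopen_diff.
      * intros k m x Hkm [h h']; split; [apply (Ui (max n k)); [lia | exact h] | exact h'].
      * intros k; pose proof (mc_diff (U (max n k)) D (HU _) HD); pose proof (Ur (max n k)).
        assert (mc (cap (U n) D) <= mc (cap (U (max n k)) D)).
        { apply mc_mono; auto using clopen_cap.
          intros x [h h']; split; [apply (Ui n); [lia | exact h] | exact h']. }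
        lra.
      * intros x [hA hD]; destruct (Uc x hA) as [k Hk]; exists k; split; [|exact hD].
        apply (Ui k); [lia | exact Hk].
    + intros x [hA hD]; destruct (Uc x hA) as [k Hk]; exists k; now split.
  - eapply Rle_trans; [|apply mu_subadd]; apply mu_mono.
    intros x Hx; unfold cup, cap, diff; destruct (classic (D x)); tauto.
Qed.

(** * Covers by cylinders and open supersets *)

Lemma pt_above N u i : (u < 2 ^ N)%nat -> (N <= i)%nat -> pt u i = false.
Proof.
  intros Hu Hi; unfold pt; rewrite <- (Nat.mod_small u (2 ^ N)) by exact Hu.
  now apply Nat.mod_pow2_bits_high.
Qed.

Lemma pt_top N u : (u < 2 ^ N)%nat -> pt (2 ^ N + u) N = true.
Proof. intros Hu; apply (Nat.testbit_unique _ N true u 0); simpl Nat.b2n; lia. Qed.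

Lemma pt_approx (x : Cspace) N : exists u, (u < 2 ^ N)%nat /\ forall i, (i < N)%nat -> pt u i = x i.
Proof.
  induction N as [|N (u & Hu & E)]; [exists 0%nat; split; [simpl; lia | lia]|].
  exists (if x N then 2 ^ N + u else u)%nat; split; [simpl; destruct (x N); lia|].
  intros i Hi; destruct (Nat.eq_dec i N) as [->|h].
  - destruct (x N); [now apply pt_top | now apply (pt_above N)].
  - destruct (x N); [rewrite pt_low by lia|]; apply E; lia.
Qed.

Lemma pt_inj N u v : (u < 2 ^ N)%nat -> (v < 2 ^ N)%nat ->
  (forall i, (i < N)%nat -> pt u i = pt v i) -> u = v.
Proof.
  intros Hu Hv E; apply Nat.bits_inj; intros i.
  destruct (Nat.lt_ge_cases i N) as [h|h]; [now apply E|].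
  transitivity false; [|symmetry]; now apply (pt_above N).
Qed.

Lemma lev_cyl s : lev (length s) (cyl s).
Proof. intros x y E Hx i Hi; rewrite <- E by exact Hi; now apply Hx. Qed.

Lemma cyl_snoc s b x : cyl (s ++ [b]) x <-> cyl s x /\ x (length s) = b.
Proof.
  unfold cyl; rewrite length_app; simpl length; split.
  - intros H; split.
    + intros i Hi; rewrite H by lia; now apply app_nth1.
    + rewrite H by lia; apply nth_middle.
  - intros [H E] i Hi; destruct (Nat.eq_dec i (length s)) as [->|h].
    + now rewrite E, nth_middle.
    + rewrite app_nth1 by lia; apply H; lia.
Qed.

Lemma cnt_cyl s : cnt (length s) (fun u => cyl s (pt u)) = 1%nat.
Proof.
  induction s as [|b s IH] using rev_ind.
  - unfold cnt; simpl; apply chi_true; intros i Hi; simpl in Hi; lia.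
  - rewrite length_app, Nat.add_1_r; unfold cnt in *.
    replace (2 ^ S (length s))%nat with (2 ^ length s + 2 ^ length s)%nat by (simpl; lia).
    set (N := length s) in *; rewrite bsum_app.
    assert (E0 : bsum (2 ^ N) (fun u => chi (cyl (s ++ [b]) (pt u))) = (if b then 0 else 1)%nat).
    { transitivity (bsum (2 ^ N) (fun u => if b then 0 else chi (cyl s (pt u)))%nat).
      - apply bsum_ext; intros u Hu; rewrite (chi_iff _ _ (cyl_snoc s b (pt u))); fold N.
        rewrite (pt_above N) by auto; destruct b;
          [apply chi_false; intros [_ h]; discriminate h | apply chi_iff; tauto].
      - destruct b; [|exact IH]; clear; induction (2 ^ N)%nat; simpl; lia. }
    assert (E1 : bsum (2 ^ N) (fun u => chi (cyl (s ++ [b]) (pt (2 ^ N + u)))) =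
                 (if b then 1 else 0)%nat).
    { transitivity (bsum (2 ^ N) (fun u => if b then chi (cyl s (pt u)) else 0)%nat).
      - apply bsum_ext; intros u Hu; rewrite (chi_iff _ _ (cyl_snoc s b _)); fold N.
        rewrite pt_top by exact Hu; destruct b;
          [|apply chi_false; intros [_ h]; discriminate h].
        apply chi_iff; split; [intros [h _] | intros h; split; [|reflexivity]];
          apply (lev_cyl s _ _) with (2 := h); intros i Hi; [|symmetry]; now apply pt_low.
      - destruct b; [exact IH|]; clear; induction (2 ^ N)%nat; simpl; lia. }
    rewrite E0, E1; now destruct b.
Qed.

Lemma mc_cyl s : mc (cyl s) = (/ 2) ^ length s.
Proof.
  rewrite (mcE _ _ (lev_cyl s)); unfold mcN; rewrite cnt_cyl.
  rewrite pow_inv; unfold Rdiv; simpl INR; lra.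
Qed.

Definition piece (c : nat -> option (list bool)) (k : nat) (x : Cspace) : Prop :=
  exists s, c k = Some s /\ cyl s x.

Lemma piece_clopen_mc c k : clopen (piece c k) /\ mc (piece c k) = weight c k.
Proof.
  unfold weight; destruct (c k) as [s|] eqn:E.
  - assert (H : forall x, cyl s x <-> piece c k x).
    { intros x; split; [intros Hx; now exists s|].
      intros (t & Ht & Hx); rewrite E in Ht; injection Ht as <-; exact Hx. }
    assert (Hc : clopen (cyl s)) by (eexists; apply lev_cyl).
    split; [now apply (clopen_iff (cyl s))|].
    now rewrite <- (mc_ext (cyl s) (piece c k)), mc_cyl.
  - assert (H : forall x, ~ piece c k x) by (intros x (t & Ht & _); congruence).
    split; [exists 0%nat; intros x y _ h; now destruct (H x) | now apply mc_empty].
Qed.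

Definition pieces (c : nat -> option (list bool)) (n : nat) (x : Cspace) : Prop :=
  exists k, (k < S n)%nat /\ piece c k x.

Lemma pieces_clopen c n : clopen (pieces c n).
Proof. apply clopen_bounded_cup; intros k _; apply piece_clopen_mc. Qed.

Lemma pieces_mc_le c n : mc (pieces c n) <= sum_f_R0 (weight c) n.
Proof.
  rewrite <- mu_clopen by apply pieces_clopen.
  (* Setting the weights beyond [n] to 0 turns the countable bound into one for a finite union. *)
  eapply Rle_trans; [|apply (mu_countable (fun k x => (k < S n)%nat /\ piece c k x)
    (fun k => if le_lt_dec k n then weight c k else 0))].
  - apply mu_mono; intros x (k & Hk & Hx); now exists k.
  - intros k; rewrite <- (proj2 (piece_clopen_mc c k)), <- mu_clopen by apply piece_clopen_mc.
    destruct (le_lt_dec k n).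
    + apply mu_mono; tauto.
    + rewrite (mu_ext _ (fun _ => False)) by (intros x; lia || (intuition lia)).
      rewrite mu_clopen by apply clopen_const; rewrite mc_empty; [lra | tauto].
  - assert (Hp : forall k, 0 <= weight c k).
    { intros k; rewrite <- (proj2 (piece_clopen_mc c k)); apply mc_bounds, piece_clopen_mc. }
    intros m; destruct (Nat.le_gt_cases m n) as [h|h].
    + apply Rle_trans with (sum_f_R0 (weight c) m).
      * apply sum_Rle; intros k Hk; destruct (le_lt_dec k n); [lra | lia].
      * clear - h Hp; induction h as [|n h IH]; simpl; [lra|]; specialize (Hp (S n)); lra.
    + replace m with (n + (m - n))%nat by lia; induction (m - n)%nat as [|d IH].
      * rewrite Nat.add_0_r; apply sum_Rle; intros k Hk; destruct (le_lt_dec k n); [lra | lia].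
      * rewrite Nat.add_succ_r, tech5; destruct (le_lt_dec (S (n + d)) n); [lia | lra].
Qed.

Lemma pieces_mc_disjoint c n :
  (forall j k x, piece c j x -> piece c k x -> j = k) ->
  mc (pieces c n) = sum_f_R0 (weight c) n.
Proof.
  intros Hd; induction n as [|n IH]; simpl.
  - rewrite <- (proj2 (piece_clopen_mc c 0)); apply mc_ext; [apply pieces_clopen|].
    intros x; split; [intros (k & Hk & Hx); now replace k with 0%nat in Hx by lia|].
    intros Hx; exists 0%nat; auto.
  - destruct (piece_clopen_mc c (S n)) as [Hc <-]; rewrite <- IH.
    pose proof (mc_modular _ _ (pieces_clopen c n) Hc) as H.
    rewrite (mc_empty (cap _ _)) in H.
    + rewrite <- H, Rplus_0_r; apply mc_ext; [apply pieces_clopen|].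
      intros x; split.
      * intros (k & Hk & Hx); destruct (Nat.eq_dec k (S n)) as [->|h]; [now right|].
        left; exists k; split; [lia | exact Hx].
      * intros [(k & Hk & Hx)|Hx]; [exists k; auto | exists (S n); auto].
    + intros x [(k & Hk & Hx) Hx']; pose proof (Hd _ _ _ Hx Hx'); lia.
Qed.

Lemma weight_growing c : Un_growing (fun N => sum_f_R0 (weight c) N).
Proof.
  intros n; simpl; enough (0 <= weight c (S n)) by lra.
  rewrite <- (proj2 (piece_clopen_mc c (S n))); apply mc_bounds, piece_clopen_mc.
Qed.

Lemma leq_of_cover A c l : covers A c -> cover_sum c l -> leq A l.
Proof.
  intros HA Hl; exists (pieces c); split; [apply pieces_clopen|]; split; [|split].
  - intros n m x Hnm (k & Hk & Hx); exists k; split; [lia | exact Hx].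
  - intros n; eapply Rle_trans; [apply pieces_mc_le|].
    exact (growing_ineq _ _ (weight_growing c) Hl n).
  - intros x Hx; destruct (HA x Hx) as (n & s & Hs); exists n, n; split; [lia | now exists s].
Qed.

(** The open set is cut into the differences [D n] of its stages, and each of these into cylinders
    of a length [L n] that determines it. The pieces are disjoint, so their weights sum to the
    measure of their union without overcounting. *)
Lemma cover_of_leq A r : leq A r -> exists c l, covers A c /\ cover_sum c l /\ l <= r.
Proof.
  intros (U & HU & Ui & Ur & Uc).
  set (D n x := U n x /\ forall m, (m < n)%nat -> ~ U m x).
  assert (HD : forall n, exists N, lev N (D n)).
  { intros n; apply (clopen_iff (diff (U n) (fun x => exists m, (m < n)%nat /\ U m x))).
    - intros x; unfold diff, D; firstorder.
    - apply clopen_diff; [apply HU | now apply clopen_bounded_cup]. }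
  apply choice in HD as [L HL].
  set (c k := let '(n, u) := Cantor.of_nat k in
    if excluded_middle_informative ((u < 2 ^ L n)%nat /\ D n (pt u))
    then Some (map (pt u) (seq 0 (L n))) else None).
  assert (Hcyl : forall u N x, cyl (map (pt u) (seq 0 N)) x <-> forall i, (i < N)%nat -> x i = pt u i).
  { intros u N x; unfold cyl; rewrite length_map, length_seq.
    split; intros H i Hi; specialize (H i Hi);
      rewrite (nth_indep _ false (pt u 0%nat)) in * by (now rewrite length_map, length_seq);
      rewrite map_nth, seq_nth in * by exact Hi; exact H. }
  assert (Hp : forall k x, piece c k x <-> let '(n, u) := Cantor.of_nat k in
    (u < 2 ^ L n)%nat /\ D n x /\ forall i, (i < L n)%nat -> x i = pt u i).
  { intros k x; unfold piece, c; destruct (Cantor.of_nat k) as [n u].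
    destruct excluded_middle_informative as [[Hu HDu]|h]; split.
    - intros (s & E & Hx); injection E as <-; rewrite Hcyl in Hx.
      split; [exact Hu|]; split; [|exact Hx].
      apply (HL n (pt u)); [intros; symmetry; auto | exact HDu].
    - intros (_ & _ & Hx); eexists; split; [reflexivity | now apply Hcyl].
    - intros (s & E & _); discriminate E.
    - intros (Hu & HDx & Hx); destruct h; split; [exact Hu | now apply (HL n x)]. }
  assert (Hdis : forall j k x, piece c j x -> piece c k x -> j = k).
  { intros j k x; rewrite !Hp, <- (Cantor.cancel_to_of j), <- (Cantor.cancel_to_of k), !Cantor.cancel_of_to.
    destruct (Cantor.of_nat j) as [n u], (Cantor.of_nat k) as [m v].
    intros (Hu & [Un Nn] & Eu) (Hv & [Um Nm] & Ev).
    assert (n = m) as <-.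
    { destruct (Nat.lt_trichotomy n m) as [h|[h|h]]; [now destruct (Nm n h)|exact h|now destruct (Nn m h)]. }
    do 2 f_equal; apply (pt_inj (L n)); auto.
    intros i Hi; rewrite <- Eu, <- Ev; auto. }
  assert (Hle : forall N, sum_f_R0 (weight c) N <= r).
  { intros N; rewrite <- pieces_mc_disjoint by exact Hdis.
    (* A piece with index [k], the code of [(n, u)], lies in [U n], and [n <= k <= N]. *)
    apply Rle_trans with (mc (U N)); [|apply Ur].
    apply mc_mono; [apply pieces_clopen | apply HU|].
    intros x (k & Hk & Hx); apply Hp in Hx; pose proof (unpair_le k) as Hle.
    destruct (Cantor.of_nat k) as [n u]; simpl in Hle.
    destruct Hx as (_ & [Hx _] & _); apply (Ui n); [lia | exact Hx]. }
  destruct (growing_cv _ (weight_growing c)) as [l Hl].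
  { exists r; intros y [N ->]; apply Hle. }
  exists c, l; split; [|split; [exact Hl|]].
  - intros x Hx; destruct (Uc x Hx) as [n0 Hn0].
    assert (exists n, D n x) as [n Hn].
    { destruct (dec_inh_nat_subset_has_unique_least_element (fun n => U n x)) as (n & [H1 H2] & _).
      - intros n; apply classic.
      - now exists n0.
      - exists n; split; [exact H1|]; intros m Hm h; specialize (H2 m h); lia. }
    destruct (pt_approx x (L n)) as (u & Hu & E).
    assert (H : piece c (Cantor.to_nat (n, u)) x).
    { apply Hp; rewrite Cantor.cancel_of_to; repeat split; try apply Hn; auto.
      intros i Hi; symmetry; auto. }
    destruct H as (s & Hs); eexists; exists s; exact Hs.
  - apply Rnot_lt_le; intros h.
    destruct (Hl (l - r)) as [N HN]; [lra|]; specialize (HN N (Nat.le_refl N)).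
    unfold Rdist in HN; apply Rabs_def2 in HN; specialize (Hle N); lra.
Qed.

Lemma m_val_mu A r : m_val A r -> r = mu A.
Proof.
  intros [H1 H2]; apply Rle_antisym.
  - apply le_of_leq; intros s Hs; apply cover_of_leq in Hs as (c & l & Hc & Hl & Hle).
    pose proof (H1 c l Hc Hl); lra.
  - apply Rnot_lt_le; intros h; destruct (H2 (mu A - r)) as (c & l & Hc & Hl & Hlt); [lra|].
    pose proof (mu_le A l (leq_of_cover A c l Hc Hl)); lra.
Qed.

(** * Measurability of Suslin sets *)

Definition sd (A B : Cspace -> Prop) (x : Cspace) : Prop := (A x /\ ~ B x) \/ (B x /\ ~ A x).

(** On Cantor space this is equivalent to measurability, in the form that the recursion uses: the
    approximants can be coded by numbers. *)
Definition meas (A : Cspace -> Prop) : Prop :=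
  forall eps, 0 < eps -> exists E, clopen E /\ mu (sd A E) <= eps.

Definition Sus (P : nat -> Cspace -> Prop) (x : Cspace) : Prop :=
  exists g, forall n, P (fbar g n) x.

(* The [n]-th clopen approximation, from above, of the part of [Sus E] obtained from
   branches bounded by [h]. Only the sets [E t] with [t < n] enter, so that it is
   determined by the first [n] values of [E] and [h]. *)
Definition hull (E : nat -> Cspace -> Prop) (h : nat -> nat) (n : nat) (x : Cspace) : Prop :=
  exists s, length s = n /\ (forall i, (i < n)%nat -> (nth i s 0 <= h i)%nat) /\
    forall t, (seqcode t < n)%nat -> (exists s', s = t ++ s') -> E (seqcode t) x.

Lemma nth_map_seq (f : nat -> nat) n i : (i < n)%nat -> nth i (map f (seq 0 n)) 0%nat = f i.
Proof.
  intros Hi; rewrite (nth_indep _ 0%nat (f 0%nat)) by (now rewrite length_map, length_seq).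
  now rewrite map_nth, seq_nth.
Qed.

Lemma prefix_map_seq (g : nat -> nat) n t s :
  map g (seq 0 n) = t ++ s -> t = map g (seq 0 (length t)).
Proof.
  intros H; assert (L : (length t + length s = n)%nat).
  { rewrite <- length_app, <- H; now rewrite length_map, length_seq. }
  apply (nth_ext _ _ 0%nat 0%nat); [now rewrite length_map, length_seq|].
  intros i Hi; rewrite nth_map_seq by exact Hi.
  rewrite <- (app_nth1 t s) by exact Hi; rewrite <- H; apply nth_map_seq; lia.
Qed.

Lemma lev_hull N E h n : (forall t, (t < n)%nat -> lev N (E t)) -> lev N (hull E h n).
Proof.
  intros H x y Exy (s & L & Hs & HE); exists s; repeat split; auto.
  intros t Ht Hp; apply (H _ Ht x); auto.
Qed.

Lemma clopen_hull E h n : (forall t, clopen (E t)) -> clopen (hull E h n).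
Proof.
  intros H; destruct (bounded_witness (fun t N => lev N (E t))) with (b := n) as [N HN].
  - intros t N M; apply lev_le.
  - intros t _; apply H.
  - exists N; now apply lev_hull.
Qed.

Lemma hull_decreasing E h n m x : (n <= m)%nat -> hull E h m x -> hull E h n x.
Proof.
  intros Hnm (s & L & Hs & HE); exists (firstn n s); split; [rewrite length_firstn; lia|]; split.
  - intros i Hi; rewrite nth_firstn; destruct (Nat.ltb_spec i n); [apply Hs; lia | lia].
  - intros t Ht [s' E']; apply HE; [lia|]; exists (s' ++ skipn n s).
    now rewrite app_assoc, <- E', firstn_skipn.
Qed.

Lemma hull_inter E h x : (forall n, hull E h n x) -> Sus E x.
Proof.
  intros H.
  destruct (konig h (fun s => forall t, (seqcode t < length s)%nat -> (exists s', s = t ++ s') ->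
    E (seqcode t) x)) as (g & _ & Hg).
  - intros s u Hu t Ht [s' E']; apply Hu; [rewrite length_app; lia|].
    exists (s' ++ u); now rewrite E', app_assoc.
  - intros n; destruct (H n) as (s & L & Hs & HE); exists s; rewrite L; auto.
  (* This length contains the segment of length [k] and also exceeds its code, so that the segment
     is among those tested. *)
  - exists g; intros k; apply (Hg (S (max k (fbar g k)))).
    + rewrite length_map, length_seq; unfold fbar; lia.
    + exists (map g (seq k (S (max k (fbar g k)) - k))); rewrite <- map_app; f_equal.
      rewrite <- seq_app; f_equal; lia.
Qed.

(** [B s] consists of the points of [D] with a branch bounded by [s] on its first coordinates. It is
    the increasing union over [j] of the [B (s ++ [j])], so continuity of outer measure provides a
    [j] that keeps the value above [q]. *)
Lemma suslin_hull E (D : Cspace -> Prop) q :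
  q < mu (cap (Sus E) D) -> exists h, forall n, q < mu (cap (hull E h n) D).
Proof.
  intros Hq.
  set (B s x := (exists g, (forall i, (i < length s)%nat -> (g i <= nth i s 0)%nat) /\
    forall n, E (fbar g n) x) /\ D x).
  destruct (dependent_choice (fun s => q < mu (B s)) (fun _ _ => True)) as [h Hh].
  - eapply Rlt_le_trans; [exact Hq|]; apply mu_mono.
    intros x [[g Hg] HD]; split; [|exact HD]; exists g; split; [simpl; lia | exact Hg].
  - intros s Hs; apply NNPP; intros Hn; apply (Rlt_not_le _ _ Hs).
    apply Rle_trans with (mu (fun x => exists j, B (s ++ [j]) x)).
    + apply mu_mono; intros x [(g & Hb & Hg) HD]; exists (g (length s)); split; [|exact HD].
      exists g; split; [|exact Hg]; rewrite length_app; simpl length; intros i Hi.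
      destruct (Nat.eq_dec i (length s)) as [->|Hne]; [now rewrite nth_middle|].
      rewrite app_nth1 by lia; apply Hb; lia.
    + apply mu_increasing.
      * intros j k x Hjk [(g & Hb & Hg) HD]; split; [|exact HD].
        exists g; split; [|exact Hg]; rewrite length_app in *; simpl length in *; intros i Hi.
        specialize (Hb i Hi); destruct (Nat.eq_dec i (length s)) as [->|Hne].
        -- rewrite nth_middle in *; lia.
        -- rewrite app_nth1 in * by lia; exact Hb.
      * intros j; apply Rnot_lt_le; intros h; apply Hn; exists j; auto.
  - exists h; intros n; destruct (Hh n) as [H _]; eapply Rlt_le_trans; [exact H|].
    apply mu_mono; intros x [(g & Hb & Hg) HD]; split; [|exact HD].
    rewrite length_map, length_seq in Hb.
    exists (map g (seq 0 n)); split; [now rewrite length_map, length_seq|]; split.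
    + intros i Hi; rewrite nth_map_seq by exact Hi; specialize (Hb i Hi).
      now rewrite nth_map_seq in Hb.
    + intros t _ [s' E']; rewrite (prefix_map_seq _ _ _ _ E'); apply Hg.
Qed.

Lemma sum_half eps n : sum_f_R0 (fun t => eps * (/ 2) ^ S t) n = eps * (1 - (/ 2) ^ S n).
Proof. induction n as [|n IH]; [simpl; lra|]; rewrite tech5, IH; simpl; lra. Qed.

(** A point on which [P t] and [Q t] agree for all [t] lies in both Suslin sets or in neither, so
    countable subadditivity applies. *)
Lemma mu_sd_Sus P Q eps : 0 <= eps -> (forall t, mu (sd (P t) (Q t)) <= eps * (/ 2) ^ S t) ->
  mu (sd (Sus P) (Sus Q)) <= eps.
Proof.
  intros He H; apply Rle_trans with (mu (fun x => exists t, sd (P t) (Q t) x)).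
  - apply mu_mono; intros x Hx; apply NNPP; intros Hn.
    assert (E : forall t, P t x <-> Q t x).
    { intros t; pose proof (not_ex_all_not _ _ Hn t) as Ht; unfold sd in Ht.
      destruct (classic (P t x)), (classic (Q t x)); tauto. }
    destruct Hx as [[[g Hg] h]|[[g Hg] h]]; apply h; exists g; intros n; apply E, Hg.
  - apply (mu_countable _ _ _ H); intros n; rewrite sum_half.
    assert (0 < (/ 2) ^ S n) by (apply pow_lt; lra).
    assert (0 <= eps * (/ 2) ^ S n) by (apply Rmult_le_pos; lra); lra.
Qed.

Lemma mu_cap_sd A B D : mu (cap A D) <= mu (cap B D) + mu (sd A B).
Proof.
  eapply Rle_trans; [|apply mu_subadd]; apply mu_mono.
  intros x; unfold cup, cap, sd; destruct (classic (B x)); tauto.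
Qed.

Lemma meas_clopen A : clopen A -> meas A.
Proof.
  intros H eps He; exists A; split; [exact H|].
  rewrite (mu_ext _ (fun _ => False)) by (unfold sd; tauto).
  rewrite mu_clopen, mc_empty; auto using clopen_const; lra.
Qed.

Lemma meas_compl A : meas A -> meas (fun x => ~ A x).
Proof.
  intros H eps He; destruct (H eps He) as (E & HE & Hm).
  exists (diff (fun _ => True) E); split; [apply clopen_diff; auto using clopen_const|].
  rewrite (mu_ext _ (sd A E)); [exact Hm|].
  intros x; unfold sd, diff; destruct (classic (A x)), (classic (E x)); tauto.
Qed.

(** The approximant is a late [K n]. The part of [Sus E] outside it has measure at most [eps / 3],
    because [Sus E] meets [K n] in at least [q]. A point of [K n] outside [Sus E] leaves some [K m],
    so these points amount to at most [mc (K n) - q < 2 * eps / 3]. *)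
Lemma meas_Sus_clopen E : (forall t, clopen (E t)) -> meas (Sus E).
Proof.
  intros HE eps Heps; set (q := mu (Sus E) - eps / 3).
  assert (HT : forall A, mu (cap A (fun _ => True)) = mu A).
  { intros A; apply mu_ext; unfold cap; tauto. }
  destruct (suslin_hull E (fun _ => True) q) as [h Hh]; [rewrite HT; unfold q; lra|].
  set (K := hull E h); assert (HK : forall n, clopen (K n)) by (intros n; now apply clopen_hull).
  assert (Kq : forall n, q <= mc (K n)).
  { intros n; specialize (Hh n); rewrite HT, mu_clopen in Hh by apply HK; now left. }
  assert (Kd : forall n m x, (n <= m)%nat -> K m x -> K n x) by (intros n m x; apply hull_decreasing).
  assert (exists n, mc (K n) < mu (Sus E) + eps / 3) as [n Hn].
  { apply NNPP; intros Hno.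
    enough (mu (Sus E) + eps / 3 <= mu (Sus E)) by lra.
    apply (mu_inter_ge K); auto; [|intros x; apply hull_inter].
    intros n; apply Rnot_lt_le; intros hlt; apply Hno; now exists n. }
  exists (K n); split; [apply HK|].
  apply Rle_trans with (mu (diff (Sus E) (K n)) + mu (diff (K n) (Sus E))); [apply mu_subadd|].
  assert (q <= mu (cap (Sus E) (K n))).
  { apply (mu_inter_ge K); auto; intros x Hx; split; [now apply (hull_inter E h) | apply Hx]. }
  pose proof (mu_split (Sus E) (K n) (HK n)).
  enough (mu (diff (K n) (Sus E)) <= mc (K n) - q) by (unfold q in *; lra).
  apply (mu_open_le (fun m => diff (K n) (K m))).
  - intros m; apply clopen_diff; auto.
  - intros k m x Hkm [H1 H2]; split; [exact H1|]; intros H3; apply H2; now apply (Kd k m).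
  - intros m; pose proof (mc_diff (K n) (K m) (HK n) (HK m)).
    enough (q <= mc (cap (K n) (K m))) by lra.
    eapply Rle_trans; [apply (Kq (max n m))|]; apply mc_mono; auto using clopen_cap.
    intros x Hx; split; apply (Kd _ (max n m)); auto; lia.
  - intros x [H1 H2]; apply NNPP; intros Hno; apply H2; apply (hull_inter E h).
    intros m; apply NNPP; intros Hm; apply Hno; exists m; now split.
Qed.

Lemma meas_Sus P : (forall t, meas (P t)) -> meas (Sus P).
Proof.
  intros HP eps Heps.
  destruct (choice (fun t E => clopen E /\ mu (sd (P t) E) <= eps / 2 * (/ 2) ^ S t)) as [E HE].
  { intros t; apply HP, Rmult_lt_0_compat; [lra | apply pow_lt; lra]. }
  destruct (meas_Sus_clopen E (fun t => proj1 (HE t)) (eps / 2)) as (C & HC & Hm); [lra|].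
  exists C; split; [exact HC|].
  pose proof (mu_sd_Sus P E (eps / 2) ltac:(lra) (fun t => proj2 (HE t))).
  apply Rle_trans with (mu (sd (Sus P) (Sus E)) + mu (sd (Sus E) C)); [|lra].
  eapply Rle_trans; [|apply mu_subadd]; apply mu_mono.
  intros x; unfold cup, sd; destruct (classic (Sus E x)); tauto.
Qed.

(** For clopen [E] in place of [P] this is [mu_split], and the replacement changes each of the two
    terms by at most [mu (sd P E)]. A third of the supposed excess bounds that error, and two such
    errors cannot make up the excess. *)
Lemma meas_add P D : meas P -> clopen D -> mu (cap P D) + mu (diff D P) = mc D.
Proof.
  intros HP HD; rewrite <- mu_clopen by exact HD; apply Rle_antisym.
  - apply Rnot_lt_le; intros h.
    destruct (HP ((mu (cap P D) + mu (diff D P) - mu D) / 3)) as (E & HE & Hm); [lra|].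
    pose proof (mu_cap_sd P E D); pose proof (mu_split D E HE).
    assert (mu (cap E D) = mu (cap D E)) by (apply mu_ext; unfold cap; tauto).
    assert (mu (diff D P) <= mu (diff D E) + mu (sd P E)).
    { eapply Rle_trans; [|apply mu_subadd]; apply mu_mono.
      intros x; unfold cup, diff, sd; destruct (classic (E x)); tauto. }
    lra.
  - eapply Rle_trans; [|apply mu_subadd]; apply mu_mono.
    intros x; unfold cup, cap, diff; destruct (classic (P x)); tauto.
Qed.

(** * Correctness of the recursion *)

Definition cl (e : nat) (x : Cspace) : Prop := exists cs, seqcode cs = e /\ clopen_of cs x.

Lemma cl_code cs x : cl (seqcode cs) x <-> clopen_of cs x.
Proof.
  split; [|now exists cs].
  intros (cs' & E & H); now apply seqcode_inj in E as <-.
Qed.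

Lemma lev_cl e : lev e (cl e).
Proof.
  intros x y E (cs & <- & b & Hb & Hx); exists cs; split; [reflexivity|]; exists b; split; [exact Hb|].
  intros i Hi; rewrite <- Hx by exact Hi; symmetry; apply E.
  rewrite length_map in Hi; pose proof (length_le_code b); pose proof (In_lt_code _ _ Hb); lia.
Qed.

Lemma clopen_cl e : clopen (cl e).
Proof. exists e; apply lev_cl. Qed.

Lemma nth_bits b i : nth i (map (fun n => negb (Nat.eqb n 0)) b) false =
  negb (Nat.eqb (nth i b 0%nat) 0).
Proof. exact (map_nth (fun n => negb (Nat.eqb n 0)) b 0%nat i). Qed.

Lemma cylP_cyl u b : cylP u (seqcode b) <-> cyl (map (fun n => negb (Nat.eqb n 0)) b) (pt u).
Proof.
  unfold cylP, cyl; rewrite length_map; split; intros H i Hi.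
  - rewrite nth_bits; unfold pt.
    specialize (H i); rewrite inb_code, nthc_code in H; specialize (H Hi).
    destruct (Nat.eqb_spec (nth i b 0%nat) 0), (Nat.testbit u i); simpl; intuition congruence.
  - rewrite inb_code in Hi; rewrite nthc_code; specialize (H i Hi).
    rewrite nth_bits in H; unfold pt in H.
    rewrite H; destruct (Nat.eqb_spec (nth i b 0%nat) 0); simpl; intuition congruence.
Qed.

Lemma memP_cl u e : memP u e <-> cl e (pt u).
Proof.
  destruct (seqcode_surj e) as [cs <-]; rewrite cl_code; unfold memP, clopen_of; split.
  - intros (i & Hi & H); rewrite inb_code in Hi; rewrite nthc_code in H.
    destruct (seqcode_surj (nth i cs 0%nat)) as [b Hb]; exists b; split.
    + rewrite Hb; now apply nth_In.
    + apply cylP_cyl; now rewrite Hb.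
  - intros (b & Hb & H); apply (In_nth _ _ 0%nat) in Hb as (i & Hi & E).
    exists i; rewrite inb_code, nthc_code, E; split; [exact Hi | now apply cylP_cyl].
Qed.

Lemma cl_of_clopen A : clopen A -> exists e, forall x, cl e x <-> A x.
Proof.
  intros [N HN].
  set (bits u := map (fun i => if pt u i then 1 else 0)%nat (seq 0 N)).
  assert (Hb : forall u x, cyl (map (fun n => negb (Nat.eqb n 0)) (bits u)) x <->
    forall i, (i < N)%nat -> x i = pt u i).
  { intros u x; unfold cyl, bits; rewrite !length_map, length_seq.
    assert (E : forall i, (i < N)%nat -> nth i (map (fun n => negb (Nat.eqb n 0))
      (map (fun i => if pt u i then 1 else 0)%nat (seq 0 N))) false = pt u i).
    { intros i Hi; rewrite nth_bits, nth_map_seq by exact Hi.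
      now destruct (pt u i). }
    split; intros H i Hi; specialize (H i Hi); rewrite E in * by exact Hi; exact H. }
  exists (seqcode (map (fun u => seqcode (bits u))
    (filter (fun u => if excluded_middle_informative (A (pt u)) then true else false) (seq 0 (2 ^ N))))).
  intros x; rewrite cl_code; unfold clopen_of; split.
  - intros (b & H & Hx); apply in_map_iff in H as (u & E & Hu); apply seqcode_inj in E as <-.
    apply filter_In in Hu as [_ Hu]; destruct excluded_middle_informative as [HA|]; [|discriminate Hu].
    apply (HN (pt u)); [|exact HA]; intros i Hi; symmetry; now apply Hb.
  - intros Hx; destruct (pt_approx x N) as (u & Hu & E).
    exists (bits u); split; [|apply Hb; intros i Hi; symmetry; auto].
    apply in_map_iff; exists u; split; [reflexivity|]; apply filter_In; split; [apply in_seq; lia|].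
    destruct excluded_middle_informative as [|h]; [reflexivity|].
    destruct h; apply (HN x); [intros i Hi; symmetry; auto | exact Hx].
Qed.

Lemma Den_meas f sigma A : Den f sigma A -> meas A.
Proof.
  induction 1.
  - apply meas_clopen, (clopen_iff (cl (seqcode cs))); [apply cl_code | apply clopen_cl].
  - now apply meas_compl.
  - now apply meas_Sus.
Qed.

Definition Val (A : Cspace -> Prop) (d a b : nat) : Prop := INR a / 2 ^ b < mu (cap A (cl d)).

(** * Dyadic inequalities and correctness at each kind of node *)

Ltac dyadic :=
  rewrite ?plus_INR, ?mult_INR, ?pow_INR, ?plus_INR, ?mult_INR, ?pow_INR; change (INR 2) with 2;
  rewrite ?pow_add.

Lemma Rlt_scale (x y t : R) : 0 < t -> (x < y <-> x * t < y * t).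
Proof. intros Ht; split; [now apply Rmult_lt_compat_r | now apply Rmult_lt_reg_r]. Qed.

Lemma Rle_scale (x y t : R) : 0 < t -> (x <= y <-> x * t <= y * t).
Proof.
  intros Ht; split; [apply Rmult_le_compat_r; now left | now apply Rmult_le_reg_r].
Qed.

Lemma dyadic_leaf a b c M : (a * 2 ^ M < c * 2 ^ b)%nat <-> INR a / 2 ^ b < INR c / 2 ^ M.
Proof.
  pose proof (pow2_pos M); pose proof (pow2_pos b).
  rewrite (Rlt_scale (INR a / _) _ (2 ^ b * 2 ^ M)) by now apply Rmult_lt_0_compat.
  replace (INR a / 2 ^ b * (2 ^ b * 2 ^ M)) with (INR (a * 2 ^ M)) by (dyadic; field; lra).
  replace (INR c / 2 ^ M * (2 ^ b * 2 ^ M)) with (INR (c * 2 ^ b)) by (dyadic; field; lra).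
  split; [apply lt_INR | apply INR_lt].
Qed.

Lemma dyadic_compl a1 c a b n d :
  (a1 * 2 ^ (b + d) + a * 2 ^ (c + d) < n * 2 ^ (c + b))%nat <->
  INR a1 / 2 ^ c + INR a / 2 ^ b < INR n / 2 ^ d.
Proof.
  pose proof (pow2_pos c); pose proof (pow2_pos b); pose proof (pow2_pos d).
  rewrite (Rlt_scale (INR a1 / _ + _) _ (2 ^ c * 2 ^ b * 2 ^ d)) by (repeat apply Rmult_lt_0_compat; auto).
  replace (_ * (2 ^ c * 2 ^ b * 2 ^ d)) with (INR (a1 * 2 ^ (b + d) + a * 2 ^ (c + d)))
    by (dyadic; field; lra).
  replace (_ * (2 ^ c * 2 ^ b * 2 ^ d)) with (INR (n * 2 ^ (c + b))) by (dyadic; field; lra).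
  split; [apply lt_INR | apply INR_lt].
Qed.

Lemma dyadic_dist a1 a2 c n e k :
  (a1 * 2 ^ (e + k) + n * 2 ^ (c + k) <= a2 * 2 ^ (e + k) + 2 ^ (c + e))%nat <->
  INR a1 / 2 ^ c + INR n / 2 ^ e <= INR a2 / 2 ^ c + / 2 ^ k.
Proof.
  pose proof (pow2_pos c); pose proof (pow2_pos e); pose proof (pow2_pos k).
  rewrite (Rle_scale (INR a1 / _ + _) _ (2 ^ c * 2 ^ e * 2 ^ k)) by (repeat apply Rmult_lt_0_compat; auto).
  replace ((INR a1 / _ + _) * (2 ^ c * 2 ^ e * 2 ^ k)) with (INR (a1 * 2 ^ (e + k) + n * 2 ^ (c + k)))
    by (dyadic; field; lra).
  replace (_ * (2 ^ c * 2 ^ e * 2 ^ k)) with (INR (a2 * 2 ^ (e + k) + 2 ^ (c + e)))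
    by (dyadic; field; lra).
  split; [apply le_INR | apply INR_le].
Qed.

Lemma dyadic_suslin a b j n M :
  ((a * 2 ^ j + 2 ^ b) * 2 ^ M < n * 2 ^ (b + j))%nat <->
  INR a / 2 ^ b + / 2 ^ j < INR n / 2 ^ M.
Proof.
  pose proof (pow2_pos b); pose proof (pow2_pos j); pose proof (pow2_pos M).
  rewrite (Rlt_scale (INR a / _ + _) _ (2 ^ b * 2 ^ j * 2 ^ M)) by (repeat apply Rmult_lt_0_compat; auto).
  replace ((INR a / _ + _) * (2 ^ b * 2 ^ j * 2 ^ M)) with (INR ((a * 2 ^ j + 2 ^ b) * 2 ^ M))
    by (dyadic; field; lra).
  replace (_ * (2 ^ b * 2 ^ j * 2 ^ M)) with (INR (n * 2 ^ (b + j))) by (dyadic; field; lra).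
  split; [apply lt_INR | apply INR_lt].
Qed.

Lemma dyadic_small eps : 0 < eps -> exists c, / 2 ^ c < eps.
Proof.
  intros He; destruct (pow_lt_1_zero (/ 2)) with (y := eps) as [N HN]; auto.
  - rewrite Rabs_pos_eq; lra.
  - exists N; specialize (HN N (Nat.le_refl N)); rewrite pow_inv in HN.
    rewrite Rabs_pos_eq in HN; [exact HN|].
    left; apply Rinv_0_lt_compat, pow2_pos.
Qed.

Lemma dyadic_above y c : 0 <= y -> exists a, y < INR a / 2 ^ c <= y + / 2 ^ c.
Proof.
  intros Hy; pose proof (pow2_pos c) as P; destruct (archimed (y * 2 ^ c)) as [H1 H2].
  assert (Hz : 0 <= y * 2 ^ c) by (apply Rmult_le_pos; lra).
  exists (Z.to_nat (up (y * 2 ^ c))).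
  rewrite INR_IZR_INZ, Z2Nat.id by (apply le_IZR; lra).
  split.
  - apply (Rmult_lt_reg_r (2 ^ c)); [exact P|].
    unfold Rdiv; rewrite Rmult_assoc, Rinv_l by lra; lra.
  - apply (Rmult_le_reg_r (2 ^ c)); [exact P|].
    unfold Rdiv; rewrite Rmult_assoc, Rmult_plus_distr_r, Rinv_l by lra; lra.
Qed.

Lemma mc_cnt d M A : lev M A -> (forall u, d u <-> A (pt u)) -> mc A = INR (cnt M d) / 2 ^ M.
Proof.
  intros H E; rewrite (mcE M A H); unfold mcN; do 2 f_equal.
  apply bsum_ext; intros u _; apply chi_iff; symmetry; apply E.
Qed.

Lemma Val_leaf cs d a b : Val (clopen_of cs) d a b <-> leafP (seqcode cs) d a b.
Proof.
  unfold Val, leafP; rewrite dyadic_leaf.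
  set (e := seqcode cs); set (M := (e + d)%nat).
  assert (L : lev M (cap (cl e) (cl d))).
  { apply lev_cap; [apply (lev_le e) | apply (lev_le d)]; try apply lev_cl; unfold M; lia. }
  rewrite (mu_ext _ (cap (cl e) (cl d))).
  - rewrite mu_clopen by (now exists M); rewrite (mc_cnt (fun u => memP u e /\ memP u d) M); [tauto | exact L|].
    intros u; unfold cap; now rewrite !memP_cl.
  - intros x; unfold cap, e; now rewrite cl_code.
Qed.

Lemma mc_cl d : mc (cl d) = INR (cnt d (fun u => memP u d)) / 2 ^ d.
Proof. apply mc_cnt; [apply lev_cl | intros u; apply memP_cl]. Qed.

Lemma Val_compl A d a b : meas A -> (Val (fun x => ~ A x) d a b <-> complP (Val A) d a b).
Proof.
  intros HA; unfold Val at 1, complP.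
  pose proof (meas_add A (cl d) HA (clopen_cl d)) as H; rewrite mc_cl in H.
  rewrite (mu_ext _ (diff (cl d) A)) by (intros x; unfold cap, diff; tauto).
  split.
  - intros h.
    (* The upper bound [a1 / 2^c] overshoots by at most [2^-c], less than the gap to be
       preserved. *)
    destruct (dyadic_small (mu (diff (cl d) A) - INR a / 2 ^ b)) as [c Hc]; [lra|].
    destruct (dyadic_above (mu (cap A (cl d))) c (mu_pos _)) as (a1 & H1 & H2).
    exists c, a1; split; [unfold Val; lra|]; apply dyadic_compl; lra.
  - intros (c & a1 & Hn & Hlt); apply dyadic_compl in Hlt; unfold Val in Hn; lra.
Qed.

(** [memP] sees only points with finitely many ones; up to coordinate [max e e'], which decides
    membership in both sets, every point agrees with one of these. *)
Lemma cl_compl e e' : (forall u, memP u e <-> ~ memP u e') <-> forall x, cl e x <-> ~ cl e' x.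
Proof.
  split; intros H.
  - intros x; destruct (pt_approx x (max e e')) as (u & _ & E).
    assert (T : forall d, (d <= max e e')%nat -> cl d x <-> memP u d).
    { intros d Hd; rewrite memP_cl; split; apply lev_cl; intros i Hi; [symmetry|]; apply E; lia. }
    rewrite !T by lia; apply H.
  - intros u; rewrite !memP_cl; apply H.
Qed.

Lemma mu_sd_split P e : meas P ->
  mu (sd P (cl e)) = mu (diff P (cl e)) + mc (cl e) - mu (cap P (cl e)).
Proof.
  intros HP; pose proof (meas_add P (cl e) HP (clopen_cl e)).
  rewrite <- (mu_split _ (cl e) (clopen_cl e)).
  rewrite (mu_ext (cap _ _) (diff (cl e) P)), (mu_ext (diff (sd _ _) _) (diff P (cl e)));
    [lra | |]; intros x; unfold cap, diff, sd; tauto.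
Qed.

Lemma distP_le P e k : meas P -> distP (Val P) e k -> mu (sd P (cl e)) <= / 2 ^ k.
Proof.
  intros HP (e' & c & a1 & a2 & He & H1 & H2 & H3).
  rewrite cl_compl in He; apply dyadic_dist in H3; rewrite <- mc_cl in H3.
  rewrite mu_sd_split by exact HP.
  rewrite (mu_ext (diff _ _) (cap P (cl e'))).
  - unfold Val in *; assert (INR a2 / 2 ^ c <= mu (cap P (cl e))); [|lra].
    destruct H2 as [->|H2]; [|now left].
    simpl INR; pose proof (mu_pos (cap P (cl e))); unfold Rdiv; lra.
  - intros x; unfold diff, cap; specialize (He x); destruct (classic (cl e' x)); tauto.
Qed.

Lemma distP_of_lt P e k : meas P -> mu (sd P (cl e)) < / 2 ^ k -> distP (Val P) e k.
Proof.
  intros HP Hlt.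
  destruct (cl_of_clopen (diff (fun _ => True) (cl e))) as [e' He'].
  { apply clopen_diff; [apply clopen_const | apply clopen_cl]. }
  assert (He : forall x, cl e x <-> ~ cl e' x).
  { intros x; rewrite He'; unfold diff; destruct (classic (cl e x)); tauto. }
  rewrite mu_sd_split in Hlt by exact HP.
  rewrite (mu_ext (diff _ _) (cap P (cl e'))) in Hlt
    by (intros x; unfold diff, cap; specialize (He x); destruct (classic (cl e' x)); tauto).
  (* Rounding costs at most three units [2^-c]: one in [a1] and two in the lowered [a2]. *)
  destruct (dyadic_small ((/ 2 ^ k - (mu (cap P (cl e')) + mc (cl e) - mu (cap P (cl e)))) / 3))
    as [c Hc]; [lra|].
  destruct (dyadic_above (mu (cap P (cl e'))) c (mu_pos _)) as (a1 & H1 & H1').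
  destruct (dyadic_above (mu (cap P (cl e))) c (mu_pos _)) as (a2 & H2 & H2').
  (* Subtracting 2 brings the threshold strictly below the measure, as [Val] demands. For [a2 <= 2]
     the truncated difference is 0, which need not be strictly below; the disjunct [a2 = 0] of
     [distP] admits it. *)
  exists e', c, a1, (a2 - 2)%nat; split; [now apply cl_compl|]; split; [unfold Val; lra|].
  rewrite dyadic_dist, <- mc_cl; unfold Val.
  pose proof (Rinv_0_lt_compat _ (pow2_pos c)) as Hc0.
  destruct (Nat.le_gt_cases a2 2) as [h|h].
  - replace (a2 - 2)%nat with 0%nat by lia; split; [now left|].
    assert (INR a2 / 2 ^ c <= 2 * / 2 ^ c).
    { apply Rmult_le_compat_r; [lra|]; apply le_INR in h; exact h. }
    simpl INR; unfold Rdiv in *; lra.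
  - rewrite minus_INR by lia; change (INR 2) with 2.
    replace ((INR a2 - 2) / 2 ^ c) with (INR a2 / 2 ^ c - 2 * / 2 ^ c) by (unfold Rdiv; ring).
    split; [right|]; lra.
Qed.

Lemma hullP_hull u F n :
  hullP u (fbar F n) <->
  hull (fun t => cl (fst (Cantor.of_nat (F t)))) (fun t => snd (Cantor.of_nat (F t))) n (pt u).
Proof.
  assert (I : forall i, inb i (fbar F n) <-> (i < n)%nat).
  { intros i; unfold fbar; now rewrite inb_code, length_map, length_seq. }
  assert (Nt : forall i, (i < n)%nat -> nthc i (fbar F n) = F i).
  { intros i Hi; unfold fbar; rewrite nthc_code; now apply nth_map_seq. }
  assert (Pr : forall t s, (exists s', s = t ++ s') <-> forall i, inb i (seqcode t) ->
    inb i (seqcode s) /\ nthc i (seqcode t) = nthc i (seqcode s)).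
  { intros t s; split.
    - intros [s' ->] i; rewrite !inb_code, !nthc_code, length_app; intros Hi.
      split; [lia | symmetry; now apply app_nth1].
    - intros H; exists (skipn (length t) s); rewrite <- (firstn_skipn (length t) s) at 1; f_equal.
      assert (L : (length t <= length s)%nat).
      { destruct (length t) as [|k] eqn:Ek; [lia|].
        destruct (H k) as [Hk _]; rewrite inb_code in *; lia. }
      apply (nth_ext _ _ 0%nat 0%nat); rewrite length_firstn; [lia|]; intros i Hi.
      rewrite nth_firstn; destruct (Nat.ltb_spec i (length t)); [|lia].
      destruct (H i) as [_ E]; rewrite ?inb_code, ?nthc_code in *; [lia | symmetry; exact E]. }
  unfold hullP, hull; split.
  - intros (c & Hi & Hb & Hm); destruct (seqcode_surj c) as [s <-].
    assert (L : length s = n).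
    { pose proof (Hi n); pose proof (Hi (length s)); rewrite I, inb_code in *; lia. }
    exists s; split; [exact L|]; split.
    + intros i Hin; specialize (Hb i); rewrite I, nthc_code, Nt in Hb by exact Hin; auto.
    + intros t Ht Hp; specialize (Hm (seqcode t)); rewrite I, Nt, memP_cl in Hm by exact Ht.
      apply Hm; [exact Ht | now apply Pr].
  - intros (s & L & Hb & Hm); exists (seqcode s); split; [|split].
    + intros i; now rewrite I, inb_code, L.
    + intros i Hin; rewrite I in Hin; rewrite nthc_code, Nt by exact Hin; auto.
    + intros c Hc Hp; rewrite I in Hc; destruct (seqcode_surj c) as [t <-].
      rewrite Nt, memP_cl by exact Hc; apply Hm; [exact Hc | now apply Pr].
Qed.

Lemma Val_suslin P d a b : (forall t, meas (P t)) ->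
  (Val (Sus P) d a b <-> suslinP (fun t => Val (P t)) d a b).
Proof.
  intros HP.
  set (E := fun (F : nat -> nat) t => cl (fst (Cantor.of_nat (F t)))).
  set (h := fun (F : nat -> nat) t => snd (Cantor.of_nat (F t))).
  assert (I : forall F n t, inb t (fbar F n) <-> (t < n)%nat).
  { intros F n t; unfold fbar; now rewrite inb_code, length_map, length_seq. }
  assert (Nt : forall F n t, (t < n)%nat -> nthc t (fbar F n) = F t).
  { intros F n t Ht; unfold fbar; rewrite nthc_code; now apply nth_map_seq. }
  assert (C : forall F n, clopen (cap (hull (E F) (h F) n) (cl d))).
  { intros F n; apply clopen_cap; [apply clopen_hull; intros t|]; apply clopen_cl. }
  assert (M : forall F n, mc (cap (hull (E F) (h F) n) (cl d)) =
    INR (cnt (d + fbar F n) (fun u => hullP u (fbar F n) /\ memP u d)) / 2 ^ (d + fbar F n)).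
  { intros F n; apply mc_cnt.
    - apply lev_cap; [|apply (lev_le d); [lia | apply lev_cl]].
      apply lev_hull; intros t Ht; eapply lev_le; [|apply lev_cl].
      pose proof (unpair_le (F t)).
      assert (F t < fbar F n)%nat; [|lia].
      unfold fbar; apply In_lt_code, in_map, in_seq; lia.
    - intros u; unfold cap; now rewrite hullP_hull, memP_cl. }
  unfold Val at 1, suslinP; split.
  - intros H.
    (* With a gap above [2 * 2^-j], an approximation error of [2^-j / 4] still leaves the margin
       [2^-j]. *)
    destruct (dyadic_small ((mu (cap (Sus P) (cl d)) - INR a / 2 ^ b) / 2)) as [j Hj]; [lra|].
    exists j.
    pose proof (Rinv_0_lt_compat _ (pow2_pos j)) as Hj0.
    (* These errors are half of those that [suslinP] allows, since [distP_of_lt] needs a strict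
       inequality. *)
    destruct (choice (fun t e => mu (sd (P t) (cl e)) <= / 2 ^ j / 4 * (/ 2) ^ S t)) as [e He].
    { intros t; destruct (HP t (/ 2 ^ j / 4 * (/ 2) ^ S t)) as (B & HB & Hm).
      - apply Rmult_lt_0_compat; [lra | apply pow_lt; lra].
      - destruct (cl_of_clopen B HB) as [c Hc]; exists c.
        rewrite (mu_ext _ (sd (P t) B)); [exact Hm|].
        intros x; unfold sd; now rewrite Hc. }
    destruct (suslin_hull (fun t => cl (e t)) (cl d) (INR a / 2 ^ b + / 2 ^ j)) as [g Hg].
    { pose proof (mu_sd_Sus P (fun t => cl (e t)) (/ 2 ^ j / 4) ltac:(lra) He).
      pose proof (mu_cap_sd (Sus P) (Sus (fun t => cl (e t))) (cl d)); lra. }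
    set (F := fun t => Cantor.to_nat (e t, g t)).
    assert (FE : forall t, fst (Cantor.of_nat (F t)) = e t).
    { intros t; unfold F; now rewrite Cantor.cancel_of_to. }
    assert (Fh : forall t, snd (Cantor.of_nat (F t)) = g t).
    { intros t; unfold F; now rewrite Cantor.cancel_of_to. }
    exists F; intros n; split.
    + intros t Ht; rewrite I in Ht; rewrite Nt, FE by exact Ht.
      apply distP_of_lt; [apply HP|]; eapply Rle_lt_trans; [apply He|].
      rewrite !pow_add, <- pow_inv; simpl pow.
      pose proof (pow2_pos t) as Ht0; rewrite !pow_inv.
      pose proof (Rinv_0_lt_compat _ Ht0).
      assert (0 < / 2 ^ j * / 2 ^ t) by now apply Rmult_lt_0_compat.
      rewrite !Rinv_mult, Rinv_1; lra.
    + apply dyadic_suslin; rewrite <- M, <- mu_clopen by apply C.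
      eapply Rlt_le_trans; [apply (Hg n)|]; apply mu_mono.
      intros x [(s & L & Hs & HE) Hx]; split; [|exact Hx]; exists s; split; [exact L|]; split.
      * intros i Hi; unfold h; rewrite Fh; auto.
      * intros t Ht Hp; unfold E; rewrite FE; auto.
  - intros (j & F & HF).
    pose proof (Rinv_0_lt_compat _ (pow2_pos j)) as Hj0.
    assert (Hd : forall t, mu (sd (P t) (E F t)) <= / 2 ^ j / 2 * (/ 2) ^ S t).
    (* The first [t + 1] values of [F] include [F t], so stage [S t] already certifies this
       distance. *)
    { intros t; destruct (HF (S t)) as [Ht _]; specialize (Ht t).
      rewrite I, Nt in Ht by lia; apply distP_le in Ht; [|apply HP | lia].
      eapply Rle_trans; [exact Ht|]; rewrite !pow_add, pow_inv; simpl pow.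
      right; rewrite !Rinv_mult; lra. }
    apply mu_sd_Sus in Hd; [|lra].
    pose proof (mu_cap_sd (Sus (E F)) (Sus P) (cl d)) as H1.
    rewrite (mu_ext (sd _ _) (sd (Sus P) (Sus (E F)))) in H1 by (unfold sd; tauto).
    enough (INR a / 2 ^ b + / 2 ^ j <= mu (cap (Sus (E F)) (cl d))) by lra.
    apply (mu_inter_ge (fun n => cap (hull (E F) (h F) n) (cl d))); [apply C | | |].
    + intros n m x Hnm [H H']; split; [now apply (hull_decreasing _ _ n m) | exact H'].
    + intros n; rewrite M; left; apply dyadic_suslin, HF.
    + intros x Hx; split; [apply (hull_inter _ (h F)); intros n; apply Hx | apply (Hx 0%nat)].
Qed.

(** Taking [e = T] in [step_index] turns its assumptions about the children into the induction
    hypotheses along the tree. *)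
Lemma node_index : exists T, forall f sigma A, Den f sigma A -> calls T f sigma (Val A).
Proof.
  destruct step_index as (T & Hl & Hc & Hs); exists T; induction 1; intros d a b tl.
  - rewrite (chi_iff _ _ (Val_leaf cs d a b)); now apply Hl.
  - rewrite (chi_iff _ _ (Val_compl A d a b (Den_meas _ _ _ H0))); now apply Hc.
  - pose proof (Val_suslin P d a b (fun t => Den_meas _ _ _ (H0 t))) as E; unfold Sus in E.
    rewrite (chi_iff _ _ E).
    now apply (Hs T f sigma (fun t => Val (P t))).
Qed.

(** * From dyadic thresholds to the rational cut *)

(** [Zcode] sends negative numerators to odd numbers, where the answer is always positive as
    measures are nonnegative, and a numerator [m >= 0] to [m + m]; then a dyadic is sought that is
    at least [q] and below the measure. The clopen code 1 lists only the empty string and so denotes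
    all of [C]. *)
Definition cutP (Phi : nat -> nat -> nat -> Prop) (c : nat) : Prop :=
  exists m, fst (Cantor.of_nat c) = (m + m + 1)%nat \/
    (fst (Cantor.of_nat c) = (m + m)%nat /\
     exists a b, (m * 2 ^ b <= a * snd (Cantor.of_nat c))%nat /\ Phi 1%nat a b).

Lemma Val_full A a b : Val A 1 a b <-> INR a / 2 ^ b < mu A.
Proof.
  unfold Val; rewrite (mu_ext _ A); [tauto|].
  intros x; unfold cap; change 1%nat with (seqcode [seqcode []]); rewrite cl_code.
  split; [tauto|]; intros HA; split; [exact HA|].
  exists []; split; [now left | intros i Hi; simpl in Hi; lia].
Qed.

Lemma cutP_spec A q : cutP (Val A) (Qcode q) <-> Q2R q < mu A.
Proof.
  unfold cutP, Qcode, Q2R; rewrite Cantor.cancel_of_to; simpl fst; simpl snd.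
  destruct q as [z p]; simpl Qnum; simpl Qden.
  assert (Hp : IZR (Z.pos p) = INR (Pos.to_nat p)) by now rewrite INR_IPR.
  assert (Hp0 : 0 < INR (Pos.to_nat p)) by (apply lt_0_INR, Pos2Nat.is_pos).
  rewrite Hp; pose proof (mu_pos A) as HA; set (d := Pos.to_nat p) in *.
  assert (Hnn : forall m, (exists a b, (m * 2 ^ b <= a * d)%nat /\ Val A 1 a b) <->
    INR m * / INR d < mu A).
  { intros m.
    assert (HS : forall a b, (m * 2 ^ b <= a * d)%nat <-> INR m * / INR d <= INR a / 2 ^ b).
    { intros a b; pose proof (pow2_pos b).
      rewrite (Rle_scale (INR m * _) _ (INR d * 2 ^ b)) by now apply Rmult_lt_0_compat.
      replace (INR m * / INR d * (INR d * 2 ^ b)) with (INR (m * 2 ^ b)) by (dyadic; field; lra).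
      replace (INR a / 2 ^ b * (INR d * 2 ^ b)) with (INR (a * d)) by (dyadic; field; lra).
      split; [apply le_INR | apply INR_le]. }
    split.
    - intros (a & b & H1 & H2); apply HS in H1; rewrite Val_full in H2; lra.
    - intros H; destruct (dyadic_small (mu A - INR m * / INR d)) as [b Hb]; [lra|].
      destruct (dyadic_above (INR m * / INR d) b) as (a & H1 & H2).
      { apply Rmult_le_pos; [apply pos_INR | left; now apply Rinv_0_lt_compat]. }
      exists a, b; split; [apply HS | rewrite Val_full]; lra. }
  destruct z as [|z|z]; simpl Zcode.
  - rewrite <- (Hnn 0%nat); split.
    + intros (m & [H|[H H']]); [lia|]; now replace m with 0%nat in H' by lia.
    + intros H; exists 0%nat; right; auto.
  - replace (IZR (Z.pos z)) with (INR (Pos.to_nat z)) by now rewrite INR_IPR.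
    rewrite <- Hnn; split.
    + intros (m & [H|[H H']]); [lia|]; now replace m with (Pos.to_nat z) in H' by lia.
    + intros H; exists (Pos.to_nat z); right; split; [lia | exact H].
  - pose proof (Pos2Nat.is_pos z) as Hz; split; intros _.
    + assert (IZR (Z.neg z) < 0) by (apply (IZR_lt _ 0); reflexivity).
      pose proof (Rinv_0_lt_compat _ Hp0); nra.
    + exists (pred (Pos.to_nat z)); left; lia.
Qed.

Theorem theorem2p10 :
  exists e : nat,
    forall (f : nat -> nat) (A : Cspace -> Prop) (r : R),
      codes f A -> m_val A r ->
      forall q : Q,
        ((Q2R q < r)%R -> Comp e (mkArgs [Qcode q] [f] [Sfun]) 0) /\
        (~ (Q2R q < r)%R -> Comp e (mkArgs [Qcode q] [f] [Sfun]) 1).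
Proof.
  destruct node_index as [T HT].
  set (X := { p : (nat -> nat) * (Cspace -> Prop) * Q | codes (fst (fst p)) (snd (fst p)) }).
  (* The output 0 stands for [q] below the measure, hence the negation under [chi]. *)
  assert (H : cp (fun x : X => fst (fst (proj1_sig x))) [fun x => Qcode (snd (proj1_sig x))]
    (fun x => chi (~ cutP (Val (snd (fst (proj1_sig x)))) (Qcode (snd (proj1_sig x)))))).
  { unfold cutP; cpt.
    apply (cp_selfcall (fun _ => T) _ _ _ (fun _ => [])
      (fun y => Val (snd (fst (proj1_sig (fst (fst (fst y)))))))); cpt.
    intros [[[[p Hp] ?] ?] ?]; exact (HT _ _ _ Hp). }
  destruct H as [e He]; exists e; intros f A r Hf Hr q.
  rewrite (m_val_mu A r Hr), <- cutP_spec.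
  pose proof (He (exist _ (f, A, q) Hf : X) []) as H; simpl in H; split; intros Hq.
  - now rewrite chi_false in H by tauto.
  - now rewrite chi_true in H.
Qed.
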